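(* In the setting of the context, let $u\in\mathcal B_R$, $\epsilon>0$, and suppose that the following hold, with $U(u,\epsilon)$ and $W(u,\epsilon,s)$ as defined in the context: (a) there is a constant $v_{\min}(u)>0$ such that $\left\|\frac{d}{dt}u(t_i)\right\|_\infty\ge v_{\min}(u)$ for infinitely many $i\in\mathbb N$; (b) there is a sequence of reals $(\rho_i(u,\epsilon))_{i\in\mathbb N}$ with $\lim_{k\to\infty}\rho_k(u,\epsilon)=0$ such that for every $v\in U(u,\epsilon)$ and every $k$, $\sum_{i=k}^\infty\|v(t_i)-u(t_i)\|_\infty\le\rho_k(u,\epsilon)$; (c) there is a constant $t_{\max}(u,\epsilon)\in\left(0,\frac{v_{\min}(u)}{6a_{\max}v_{\max}}\right)$ such that for every $v\in\mathcal B_R$ with $v\notin W(u,\epsilon,t_{\max}(u,\epsilon))$, $\|v(t_i)-u(t_i)\|_\infty>2\epsilon$ for some $i\ge0$. Suppose that $q(v)>0$ for every $v\in U(u,\epsilon)$, that the observation matrix is $H=I_{d\times d}$, and that the observation errors are uniformly distributed on $[-\epsilon,\epsilon]^d$. Then $$\sup_{v\in\mathrm{supp}\,\mu^{\mathrm{sm}}(\cdot|Y_0,\ldots,Y_k)}d(v,U(u,\epsilon))\to0\quad\text{as }k\to\infty,\ \text{almost surely in the observations},$$ where $d(v,U(u,\epsilon))=\inf_{w\in U(u,\epsilon)}\|v-w\|$. Moreover, for every point $v\in U(u,\epsilon)$, $$\inf_{k\in\mathbb N}\mathbb P\big(v\in\mathrm{supp}\,\mu^{\mathrm{sm}}(\cdot|Y_0,\ldots,Y_k)\,\big|\,u\big)>0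 .$$
   Context: Dynamics: $\frac{du}{dt}=-Au-B(u,u)+f$ on $\mathbb R^d$, with $A$ a linear operator, $B:\mathbb R^d\times\mathbb R^d\to\mathbb R^d$ bilinear, $f\in\mathbb R^d$. For $v\in\mathbb R^d$, $v(t)=\Psi_t(v)$ is the solution with $v(0)=v$. Trapping ball assumption: there are $R,\delta>0$ with $\langle -Av-B(v,v)+f,v\rangle\le0$ whenever $\|v\|\in[R,R+\delta]$. $\mathcal B_R=\{v:\|v\|\le R\}$; for $v\in\mathcal B_R$ the solution exists for all $t\ge0$ and stays in $\mathcal B_R$. Put $v_{\max}:=\|A\|R+\|B\|R^2+\|f\|$ and $a_{\max}:=\|A\|+2\|B\|R$, where $\|A\|$ is the Euclidean operator norm and $\|B\|=\sup_{\|v\|=\|w\|=1}\|B(v,w)\|$. Observation times $t_i=ih$ with fixed $h>0$. For $s>0$: $U(u,\epsilon)=\left\{v\in\mathcal B_R:\ \sum_{i=0}^\infty\|v(t_i)-u(t_i)\|_\infty<\infty,\ \sup_{i\ge0}\|v(t_i)-u(t_i)\|_\infty<2\epsilon\right\}$ (the $2\epsilon$-cropped leaf set), and $W(u,\epsilon,s)$ is the set of $v\in\mathcal B_R$ with $\|u-v\|_\infty<2\epsilon$ for which there are $w\in U(u,\epsilon)$ and $t\in[-s,s]$ such that either $t\ge0$ and $w(t)=v$, or $t<0$ and $v(-t)=w$. Observations: $Y_i=u(t_i)+Z_i$, $Z_i$ i.i.d. uniform on $[-\epsilon,\epsilon]^d$ with density $\eta$, true initial point $u$. The prior $q$ is a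 probability density on $\mathbb R^d$ vanishing outside $\mathcal B_R$. The smoothing density is $\mu^{\mathrm{sm}}(v|Y_0,\ldots,Y_k)\propto q(v)\prod_{i=0}^k\eta(Y_i-\Psi_{t_i}(v))$ for $v\in\mathcal B_R$, and $0$ otherwise; its support is the set of points where it is nonzero. $\mathbb P(\cdot|u)$ is probability over the noise. *)

(* Defs.v *)
From HB Require Import structures.
From mathcomp Require Import all_boot all_order all_algebra finmap.
From mathcomp Require Import all_classical all_reals all_analysis.
From mathcomp Require Import sesquilinear.

Set Implicit Arguments.
Unset Strict Implicit.
Unset Printing Implicit Defensive.

Import Order.TTheory GRing.Theory Num.Theory.
Import numFieldNormedType.Exports.

Local Open Scope classical_set_scope.
Local Open Scope ring_scope.

Definition rV_display : measure_display -> measure_display.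
Proof. exact. Qed.

(* 'rV[R]_n carries the sigma-algebra generated by the coordinates, exactly as
   the library does for n.-tuple R; it is the Borel sigma-algebra of R^n. *)
Section rV_measurable.
Variables (R : realType) (n : nat).

Let coord (i : 'I_n) (v : 'rV[R]_n) : measurableTypeR R := v 0 i.

Let rV_set0 : g_sigma_preimage coord set0.
Proof. exact: sigma_algebra0. Qed.

Let rV_setC A : g_sigma_preimage coord A -> g_sigma_preimage coord (~` A).
Proof. exact: sigma_algebraC. Qed.

Let rV_bigcup (F : (set 'rV[R]_n)^nat) :
  (forall i, g_sigma_preimage coord (F i)) ->
  g_sigma_preimage coord (\bigcup_i F i).
Proof. exact: sigma_algebra_bigcup. Qed.

HB.instance Definition _ := @isMeasurable.Build
  (rV_display default_measure_display)
  'rV[R]_n (g_sigma_preimage coord) rV_set0 rV_setC rV_bigcup.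

Lemma measurable_rV_coord (i : 'I_n) :
  measurable_fun [set: 'rV[R]_n] (fun v : 'rV[R]_n => v 0 i : measurableTypeR R).
Proof.
move=> _ Y mY; rewrite setTI; apply: sub_sigma_algebra => /=.
rewrite -bigcup_seq/=; exists i => /=; first by rewrite mem_index_enum.
by exists Y => //; rewrite setTI.
Qed.

Lemma measurable_fun_rV d (T : measurableType d) (g : T -> 'rV[R]_n) :
  (forall i, measurable_fun setT (fun x => g x 0 i : measurableTypeR R)) ->
  measurable_fun setT g.
Proof.
move=> mg _ A mA; rewrite setTI.
suff : g_sigma_preimage coord `<=` [set B | measurable (g @^-1` B)].
  by apply; exact: mA.
apply: smallest_sub.
  split => /=.
  - by rewrite preimage_set0.
  - by move=> B mB; rewrite setTD preimage_setC; exact: measurableC.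
  - by move=> F mF; rewrite preimage_bigcup; exact: bigcupT_measurable.
move=> B; rewrite -bigcup_seq/= => -[i _ [C mC <-]] /=.
have := mg i measurableT C mC.
by rewrite !setTI.
Qed.

End rV_measurable.

(* Lebesgue measure on R^n, by recursion on n: the Dirac mass on the singleton
   R^0, and on R^(n+1) the image of the product of the measures on R and R^n. *)
Section lebesgue_rV.
Variable R : realType.

Definition rV_cons n (p : measurableTypeR R * 'rV[R]_n) : 'rV[R]_n.+1 :=
  \row_i oapp (p.2 0) p.1 (unlift ord0 i).

Lemma measurable_rV_cons n : measurable_fun setT (@rV_cons n).
Proof.
apply: measurable_fun_rV => i.
case: (unliftP ord0 i) => [j ->|->].
- under eq_fun do rewrite mxE liftK /=.
  exact: (measurableT_comp (measurable_rV_coord j) measurable_snd).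
- under eq_fun do rewrite mxE unlift_none /=.
  exact: measurable_fst.
Qed.

Definition rV_uncons n (v : 'rV[R]_n.+1) : measurableTypeR R * 'rV[R]_n :=
  (v 0 ord0, \row_j v 0 (lift ord0 j)).

Lemma measurable_rV_uncons n : measurable_fun setT (@rV_uncons n).
Proof.
apply: measurable_fun_pair; first exact: measurable_rV_coord.
apply: measurable_fun_rV => i; under eq_fun do rewrite mxE.
exact: measurable_rV_coord.
Qed.

Lemma rV_consK n : cancel (@rV_cons n) (@rV_uncons n).
Proof.
move=> [x v]; rewrite /rV_uncons mxE unlift_none /=; congr (_, _).
by apply/rowP => j; rewrite !mxE liftK.
Qed.

Lemma rV_unconsK n : cancel (@rV_uncons n) (@rV_cons n).
Proof.
move=> v; apply/rowP => i; rewrite mxE.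
by case: (unliftP ord0 i) => [j ->|->]; rewrite ?liftK ?unlift_none //= mxE.
Qed.

Section step.
Variables (n : nat) (m : {sigma_finite_measure set 'rV[R]_n -> \bar R}).

Definition lebesgue_rV_step : set 'rV[R]_n.+1 -> \bar R :=
  pushforward (@lebesgue_measure R \x m)%E (@rV_cons n).

Let step0 : lebesgue_rV_step set0 = 0%E.
Proof. by rewrite /lebesgue_rV_step /pushforward preimage_set0 measure0. Qed.

Let step_ge0 A : (0 <= lebesgue_rV_step A)%E.
Proof. exact: (measure_ge0 (@lebesgue_measure R \x m)%E). Qed.

Let step_sigma_additive : semi_sigma_additive lebesgue_rV_step.
Proof.
move=> F mF tF mUF; rewrite /lebesgue_rV_step /pushforward preimage_bigcup.
apply: (@measure_semi_sigma_additive _ _ _ (@lebesgue_measure R \x m)%E).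
- by move=> i; rewrite -[X in measurable X]setTI; exact: measurable_rV_cons.
- apply/trivIsetP => /= i j _ _ ij; rewrite -preimage_setI.
  by move/trivIsetP : tF => /(_ _ _ _ _ ij) ->//; rewrite preimage_set0.
- rewrite -preimage_bigcup -[X in measurable X]setTI.
  exact: measurable_rV_cons.
Qed.

HB.instance Definition _ := isMeasure.Build _ _ _ lebesgue_rV_step
  step0 step_ge0 step_sigma_additive.

Let step_sigma_finite : sigma_finite setT lebesgue_rV_step.
Proof.
have /sigma_finiteP[F [FT ndF Foo]] := sigma_finiteT (@lebesgue_measure R).
have /sigma_finiteP[G [GT ndG Goo]] := sigma_finiteT m.
exists (fun k => @rV_uncons n @^-1` (F k `*` G k)).
  apply/esym; rewrite -subTset => v _.
  have : [set: measurableTypeR R] (rV_uncons v).1 by [].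
  rewrite FT => -[k _ Fk].
  have : [set: 'rV[R]_n] (rV_uncons v).2 by [].
  rewrite GT => -[l _ Gl].
  exists (maxn k l) => //; split.
  - by move: Fk; exact/subsetPset/ndF/leq_maxl.
  - by move: Gl; exact/subsetPset/ndG/leq_maxr.
move=> k; have [mF Fk] := Foo k; have [mG Gk] := Goo k; split.
  rewrite -[X in measurable X]setTI; apply: measurable_rV_uncons => //.
  exact: measurableX.
rewrite /lebesgue_rV_step /pushforward -comp_preimage.
rewrite (_ : _ \o _ = id); last by apply/funext => p /=; rewrite rV_consK.
by rewrite preimage_id product_measure1E// lte_mul_pinfty// ge0_fin_numE.
Qed.

HB.instance Definition _ := Measure_isSigmaFinite.Build _ _ _
  lebesgue_rV_step step_sigma_finite.

End step.

Fixpoint lebesgue_rV n : {sigma_finite_measure set 'rV[R]_n -> \bar R} :=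
  if n is n'.+1 then lebesgue_rV_step (lebesgue_rV n')
  else @dirac _ 'rV[R]_0 0 R.

Lemma lebesgue_rV_box n (I : 'I_n -> set (measurableTypeR R)) :
  (forall i, measurable (I i)) ->
  lebesgue_rV n [set v : 'rV[R]_n | forall i, I i (v 0 i)] =
  (\prod_(i < n) @lebesgue_measure R (I i))%E.
Proof.
elim: n I => [|n IH] I mI.
  by rewrite big_ord0 /= diracE mem_set// => -[].
rewrite big_ord_recl -IH//.
rewrite [LHS](_ : _ = (@lebesgue_measure R \x lebesgue_rV n)%E
   (I ord0 `*` [set v : 'rV[R]_n | forall i, I (lift ord0 i) (v 0 i)])).
  rewrite product_measure1E//.
  rewrite (_ : mkset _ =
    \bigcap_(i in [set: 'I_n]) ((fun v : 'rV[R]_n => v 0 i) @^-1` I (lift ord0 i))).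
    apply: fin_bigcap_measurable => // i _.
    by rewrite -[X in measurable X]setTI; exact: measurable_rV_coord.
  by apply/seteqP; split => v /= H i; [move=> _; exact: H|exact: H].
congr (product_measure1 _ _ _); apply/seteqP; split => -[x v] /=.
- move=> H; split; first by have := H ord0; rewrite mxE unlift_none.
  by move=> i; have := H (lift ord0 i); rewrite mxE liftK.
- case=> Hx Hv i; rewrite mxE.
  by case: (unliftP ord0 i) => [j ->|->]; rewrite ?liftK ?unlift_none //=.
Qed.

End lebesgue_rV.

Section dynamics.
Variables (R : realType) (d : nat).
Implicit Types u v w : 'rV[R]_d.

(* The library norm `|v| on 'rV[R]_d is the sup norm, i.e. the paper's
   \|v\|_\infty; the Euclidean structure is defined here. *)
Definition dotp v w : R := \sum_i v 0 i * w 0 i.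

Definition enorm v : R := Num.sqrt (dotp v v).

Definition eball (r : R) : set 'rV[R]_d := [set v | enorm v <= r].

Definition dist_to v (S : set 'rV[R]_d) : R := inf [set enorm (v - w) | w in S].

Definition opnorm (A : 'rV[R]_d -> 'rV[R]_d) : R :=
  sup [set enorm (A v) | v in [set v | enorm v = 1]].

Definition bilin_opnorm (B : 'rV[R]_d -> 'rV[R]_d -> 'rV[R]_d) : R :=
  sup [set enorm (B p.1 p.2) | p in [set v | enorm v = 1] `*` [set v | enorm v = 1]].

Section vector_field.
Variables (A : {linear 'rV[R]_d -> 'rV[R]_d})
  (B : {bilinear 'rV[R]_d -> 'rV[R]_d -> 'rV[R]_d}) (f : 'rV[R]_d).

Definition vfield v : 'rV[R]_d := - A v - B v v + f.

Definition trapping_ball (r : R) : Prop := exists2 delta : R, 0 < delta &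
  forall v, r <= enorm v <= r + delta -> dotp (vfield v) v <= 0.

Definition v_max (r : R) : R :=
  opnorm A * r + bilin_opnorm (fun v w => B v w) * r ^+ 2 + enorm f.

Definition a_max (r : R) : R := opnorm A + 2 * bilin_opnorm (fun v w => B v w) * r.

End vector_field.

(* For each v in the ball, t |-> Psi t v is the solution of u' = F u on
   [0, +oo[ started at v.  Nothing is required for t < 0 or outside the ball. *)
Definition solution_map (F : 'rV[R]_d -> 'rV[R]_d) (r : R)
    (Psi : R -> 'rV[R]_d -> 'rV[R]_d) : Prop :=
  forall v, eball r v ->
  [/\ Psi 0 v = v, {within `[0, +oo[, continuous (Psi^~ v)} &
      forall t : R, 0 < t -> is_derive t 1 (Psi^~ v) (F (Psi t v))].

Section leaf_sets.
Variables (Psi : R -> 'rV[R]_d -> 'rV[R]_d) (r h eps : R).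

Definition obs_time (i : nat) : R := i%:R * h.

Definition obs_gap u v (i : nat) : R :=
  `|Psi (obs_time i) v - Psi (obs_time i) u|.

Definition cropped_leaf u : set 'rV[R]_d := [set v |
  [/\ eball r v,
      (\sum_(0 <= i <oo) (obs_gap u v i)%:E < +oo)%E &
      (ereal_sup (range (fun i => (obs_gap u v i)%:E)) < (2 * eps)%:E)%E]].

Definition leaf_tube u (s : R) : set 'rV[R]_d := [set v |
  [/\ eball r v, `|u - v| < 2 * eps &
      exists w (t : R), [/\ cropped_leaf u w, - s <= t <= s &
        (0 <= t /\ Psi t w = v) \/ (t < 0 /\ Psi (- t) v = w)]]].

End leaf_sets.

(* Density of the uniform distribution on the cube [-eps, eps]^d. *)
Definition unif_density (eps : R) (z : 'rV[R]_d) : R :=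
  \1_[set z : 'rV[R]_d | forall j, - eps <= z 0 j <= eps] z / (2 * eps) ^+ d.

Definition is_prior (r : R) (q : 'rV[R]_d -> R) : Prop :=
  [/\ forall v, 0 <= q v, measurable_fun setT q,
      (\int[lebesgue_rV R d]_v (q v)%:E = 1)%E &
      forall v, ~ eball r v -> q v = 0].

Section smoothing.
Variables (Psi : R -> 'rV[R]_d -> 'rV[R]_d) (r h eps : R) (q : 'rV[R]_d -> R).
Variables (k : nat) (Y : nat -> 'rV[R]_d).

Definition smoothing_weight v : R :=
  \1_(eball r) v *
  (q v * \prod_(i < k.+1) unif_density eps (Y i - Psi (obs_time h i) v)).

(* The fallback value 1 is used only for observations for which the weight
   vanishes almost everywhere and hence cannot be normalized; the support of the
   smoothing density is that of its weight in every case. *)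
Definition smoothing_const : R :=
  let c := fine (\int[lebesgue_rV R d]_v (smoothing_weight v)%:E)%E in
  if c == 0 then 1 else c.

Definition smoothing_density v : R := smoothing_weight v / smoothing_const.

Definition smoothing_supp : set 'rV[R]_d := [set v | smoothing_density v != 0].

End smoothing.

End dynamics.

Section noise.
Context (dT : measure_display) (T : measurableType dT) (R : realType)
  (P : probability T R) (d : nat).
Variable Z : nat -> {RV P >-> 'rV[R]_d}.

Definition mutually_independent : Prop :=
  forall (J : {fset nat}) (E : nat -> set 'rV[R]_d),
    (forall i, measurable (E i)) ->
    P (\bigcap_(i in [set` J]) (Z i @^-1` E i)) =
    (\prod_(i <- J) P (Z i @^-1` E i))%E.

Definition iid_uniform (eps : R) : Prop :=
  mutually_independent /\
  forall i (E : set 'rV[R]_d), measurable E ->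
    distribution P (Z i) E =
    (\int[lebesgue_rV R d]_(z in E) (unif_density eps z)%:E)%E.

End noise.

(* Main.v *)
Require Import Defs.
From mathcomp Require Import all_boot all_order all_algebra finmap.
From mathcomp Require Import sesquilinear.
From mathcomp Require Import all_classical all_reals all_analysis.
From mathcomp Require Import ring lra.

Import Order.TTheory GRing.Theory Num.Theory.
Import numFieldNormedType.Exports.

Local Open Scope classical_set_scope.
Local Open Scope ring_scope.

(** Write u_i, v_i for the states at the i-th observation time of the
trajectories of u and v, and F for the vector field.  Up to the positivity of
the prior, v lies in the support of the smoothing density after k observations
if and only if v is consistent with them: every noisy observation u_i + z_i,
i <= k, lies within eps of v_i in the sup norm.

Convergence of the support.  The sets of consistent points are closed subsets
of a ball (the flow is Lipschitz in its initial point, by Gronwall), and they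
decrease with k.  By compactness it is enough that almost surely every point v
consistent with all observations belongs to the leaf set U
([nested_compact_dist], [consistent_dist]).  Such a v satisfies
|v_i - u_i| <= 2 eps for all i, so it lies in the tube around U: it is obtained
from some w in U by moving for a time t with |t| <= t_max along a trajectory.
If t were not 0, then, because w_i - u_i tends to 0 and t_max is so small that
trajectories are almost straight during a time t_max, v_i - u_i would eventually
be close to t F(u_i) ([leaf_separation]).  The point is that the sign and the
large coordinate of this displacement depend on u and on the sign of t only, not
on v.  Hence one almost sure event serves for all the uncountably many
candidates v at once: for each n and each sign, infinitely often the noise in
the coordinate where F(u_i) is large comes within 1/(n+1) of the extreme value
of that sign ([noise_extreme_along]), which for 1/(n+1) < |t| v_min / 2 pushes
the observation out of the reach of v_i.  So t = 0 and v = w is in U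
([consistent_limit]).

Positive probability.  For v in U put g_i = |v_i - u_i| / (2 eps).  The i-th
observation is consistent with v with probability at least (1 - g_i)^d,
independently of the others.  The g_i are less than 1 and summable, so the
products of the 1 - g_i are bounded away from 0
([prod_one_sub_bounded_below], [smoothing_supp_probability]). *)

Set Implicit Arguments.
Unset Strict Implicit.

(** * Euclidean norm on row vectors *)

Section euclidean_norm.
Context {R : realType} {d : nat}.
Implicit Types (v w : 'rV[R]_d) (c : R).

Lemma dotpC v w : dotp v w = dotp w v.
Proof. by apply: eq_bigr => i _; rewrite mulrC. Qed.

Lemma dotpDl v1 v2 w : dotp (v1 + v2) w = dotp v1 w + dotp v2 w.
Proof. by rewrite -big_split; apply: eq_bigr => i _; rewrite mxE mulrDl. Qed.

Lemma dotpZl c v w : dotp (c *: v) w = c * dotp v w.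
Proof. by rewrite mulr_sumr; apply: eq_bigr => i _; rewrite mxE mulrA. Qed.

Lemma dotpNl v w : dotp (- v) w = - dotp v w.
Proof. by rewrite -scaleN1r dotpZl mulN1r. Qed.

Lemma dotpBl v1 v2 w : dotp (v1 - v2) w = dotp v1 w - dotp v2 w.
Proof. by rewrite dotpDl dotpNl. Qed.

Lemma dotpDr w v1 v2 : dotp w (v1 + v2) = dotp w v1 + dotp w v2.
Proof. by rewrite dotpC dotpDl !(dotpC w). Qed.

Lemma dotpBr w v1 v2 : dotp w (v1 - v2) = dotp w v1 - dotp w v2.
Proof. by rewrite dotpC dotpBl !(dotpC w). Qed.

Lemma dotpZr c v w : dotp v (c *: w) = c * dotp v w.
Proof. by rewrite dotpC dotpZl dotpC. Qed.

Lemma dotp_delta v j : dotp v (delta_mx 0 j) = v 0 j.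
Proof.
rewrite /dotp (bigD1 j)//= big1 ?addr0 ?mxE ?eqxx ?mulr1// => i ij.
by rewrite mxE (negbTE ij) andbF mulr0.
Qed.

Lemma dotp_ge0 v : 0 <= dotp v v.
Proof. by apply: sumr_ge0 => i _; rewrite -expr2 sqr_ge0. Qed.

Lemma enorm_ge0 v : 0 <= enorm v. Proof. exact: sqrtr_ge0. Qed.

Lemma enorm_sqr v : enorm v ^+ 2 = dotp v v.
Proof. by rewrite sqr_sqrtr// dotp_ge0. Qed.

Lemma coord_le_enorm v i : `|v 0 i| <= enorm v.
Proof.
rewrite -[leLHS]sqrtr_sqr /enorm ler_wsqrtr// /dotp (bigD1 i)//= expr2 lerDl.
by apply: sumr_ge0 => j _; rewrite -expr2 sqr_ge0.
Qed.

Lemma enorm_eq0 v : (enorm v == 0) = (v == 0).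
Proof.
apply/eqP/eqP => [v0|->]; last first.
  by rewrite /enorm /dotp big1 ?sqrtr0// => i _; rewrite mxE mul0r.
apply/rowP => i; rewrite mxE; apply/eqP; rewrite -normr_le0 -v0.
exact: coord_le_enorm.
Qed.

Lemma enorm0 : enorm (0 : 'rV[R]_d) = 0.
Proof. by apply/eqP; rewrite enorm_eq0. Qed.

Lemma enormZ c v : enorm (c *: v) = `|c| * enorm v.
Proof.
by rewrite /enorm dotpZl dotpZr mulrA -expr2 sqrtrM ?sqr_ge0// sqrtr_sqr.
Qed.

Lemma enormN v : enorm (- v) = enorm v.
Proof. by rewrite -scaleN1r enormZ normrN1 mul1r. Qed.

(** Cauchy-Schwarz, from the nonnegative square of |w| v - |v| w. *)
Lemma dotp_le_enorm v w : dotp v w <= enorm v * enorm w.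
Proof.
have [->|v0] := eqVneq v 0.
  by rewrite enorm0 mul0r /dotp big1// => i _; rewrite mxE mul0r.
have [->|w0] := eqVneq w 0.
  by rewrite enorm0 mulr0 /dotp big1// => i _; rewrite mxE mulr0.
have vw0 : 0 < enorm v * enorm w.
  by rewrite mulr_gt0// lt_def enorm_eq0 enorm_ge0 ?v0 ?w0.
have := dotp_ge0 (enorm w *: v - enorm v *: w).
rewrite !(dotpBl, dotpBr, dotpZl, dotpZr) (dotpC w v) -!enorm_sqr => H.
rewrite -(ler_pM2l vw0); nra.
Qed.

Lemma ler_enormD v w : enorm (v + w) <= enorm v + enorm w.
Proof.
rewrite -ler_sqr ?nnegrE ?addr_ge0 ?enorm_ge0// enorm_sqr.
rewrite !(dotpDl, dotpDr) -!enorm_sqr (dotpC w v).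
by have := dotp_le_enorm v w; nra.
Qed.

Lemma ler_enorm_sum (I : Type) (s : seq I) (F : I -> 'rV[R]_d) :
  enorm (\sum_(i <- s) F i) <= \sum_(i <- s) enorm (F i).
Proof.
elim/big_rec2 : _ => [|i y x _ h]; first by rewrite enorm0.
by rewrite (le_trans (ler_enormD _ _))// lerD2l.
Qed.

Lemma norm_le_enorm v : `|v| <= enorm v.
Proof.
rewrite [leLHS]/Num.Def.normr/= mx_normrE bigmax_le ?enorm_ge0// => -[i j] _ /=.
by rewrite ord1 coord_le_enorm.
Qed.

Lemma coord_le_norm v i : `|v 0 i| <= `|v|.
Proof.
rewrite [leRHS]/Num.Def.normr/= mx_normrE.
exact: (le_bigmax _ (fun ij => `|v ij.1 ij.2|) (0, i)).
Qed.

Lemma norm_le_coord v c : 0 <= c -> (forall i, `|v 0 i| <= c) -> `|v| <= c.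
Proof.
move=> c0 vc; rewrite [leLHS]/Num.Def.normr/= mx_normrE bigmax_le// => -[i j] _ /=.
by rewrite ord1.
Qed.

Lemma norm_coord_ex v c : 0 < c -> c <= `|v| -> exists i, c <= `|v 0 i|.
Proof.
move=> c0 cv; have : mx_norm v != 0 by rewrite gt_eqF// (lt_le_trans c0 cv).
move=> /mx_norm_neq0[[i j] /= vE]; exists j; move: cv.
by rewrite (vE : `|v| = _) ord1.
Qed.

(** Together with [norm_le_enorm], this lets Euclidean estimates be used in the
topology of row vectors, which is that of the sup norm. *)
Lemma enorm_le_norm v : enorm v <= Num.sqrt d%:R * `|v|.
Proof.
rewrite -[X in _ * X]normr_id -sqrtr_sqr -sqrtrM// ler_wsqrtr// /dotp.
rewrite mulr_natl -[X in _ *+ X]card_ord -sumr_const; apply: ler_sum => i _.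
by rewrite -expr2 -real_normK ?num_real// ler_sqr ?nnegrE// coord_le_norm.
Qed.

End euclidean_norm.

(** * Operator norms and the vector field *)

Section operator_norms.
Context {R : realType} {d : nat}.
Variables (A : {linear 'rV[R]_d -> 'rV[R]_d})
  (B : {bilinear 'rV[R]_d -> 'rV[R]_d -> 'rV[R]_d}).
Implicit Types v w : 'rV[R]_d.

Let E (i : 'I_d) : 'rV[R]_d := delta_mx 0 i.

Lemma coord_unit v i : enorm v = 1 -> `|v 0 i| <= 1.
Proof. by move=> <-; exact: coord_le_enorm. Qed.

(** Suprema of unbounded sets are 0 by convention, so the operator norms bound
anything only once the sets that define them are known to be bounded: expand the
argument on the standard basis. *)
Lemma opnorm_has_ubound :
  has_ubound [set enorm (A v) | v in [set v | enorm v = 1]].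
Proof.
exists (\sum_i enorm (A (E i))) => _ [v /= v1 <-].
rewrite [in leLHS](row_sum_delta v) linear_sum/= (le_trans (ler_enorm_sum _ _))//.
apply: ler_sum => i _; rewrite linearZ/= enormZ ler_piMl ?enorm_ge0//.
exact: coord_unit.
Qed.

Lemma bilin_opnorm_has_ubound : has_ubound
  [set enorm (B p.1 p.2) | p in [set v | enorm v = 1] `*` [set v | enorm v = 1]].
Proof.
exists (\sum_i \sum_j enorm (B (E i) (E j))) => _ [[v w] /= [v1 w1] <-].
rewrite [in leLHS](row_sum_delta v) linear_sumlz/=.
rewrite (le_trans (ler_enorm_sum _ _))//.
apply: ler_sum => i _; rewrite linearZl_LR/= enormZ.
rewrite (@le_trans _ _ (enorm (B (E i) w)))//.
  by rewrite ler_piMl ?enorm_ge0// coord_unit.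
rewrite [in leLHS](row_sum_delta w) linear_sumr/=.
rewrite (le_trans (ler_enorm_sum _ _))//.
apply: ler_sum => j _; rewrite linearZr_LR/= enormZ.
by rewrite ler_piMl ?enorm_ge0// coord_unit.
Qed.

Lemma enorm_normalize v : v != 0 -> enorm ((enorm v)^-1 *: v) = 1.
Proof.
move=> v0; rewrite enormZ ger0_norm ?invr_ge0 ?enorm_ge0// mulVf//.
by rewrite enorm_eq0.
Qed.

Lemma enormK v : enorm v *: ((enorm v)^-1 *: v) = v.
Proof.
have [->|v0] := eqVneq v 0; first by rewrite !scaler0.
by rewrite scalerA divff ?scale1r// enorm_eq0.
Qed.

Lemma enorm_opnorm v : enorm (A v) <= opnorm A * enorm v.
Proof.
have [->|v0] := eqVneq v 0; first by rewrite linear0 enorm0 mulr0.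
rewrite -[in leLHS](enormK v) linearZ/= enormZ ger0_norm ?enorm_ge0// mulrC.
rewrite ler_wpM2r ?enorm_ge0//; apply: (ub_le_sup opnorm_has_ubound) => /=.
by exists ((enorm v)^-1 *: v) => //; exact: enorm_normalize.
Qed.

Lemma enorm_bilin_opnorm v w :
  enorm (B v w) <= bilin_opnorm (fun v w => B v w) * enorm v * enorm w.
Proof.
have [->|v0] := eqVneq v 0; first by rewrite linear0l enorm0 mulr0 mul0r.
have [->|w0] := eqVneq w 0; first by rewrite linear0r enorm0 mulr0.
rewrite -[in leLHS](enormK v) linearZl_LR/= enormZ.
rewrite -[in leLHS](enormK w) linearZr_LR/= enormZ.
rewrite !ger0_norm ?enorm_ge0// mulrA mulrC -[leRHS]mulrA.
rewrite ler_wpM2r ?mulr_ge0 ?enorm_ge0//.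
apply: (ub_le_sup bilin_opnorm_has_ubound) => /=.
exists ((enorm v)^-1 *: v, (enorm w)^-1 *: w) => //=.
by split; exact: enorm_normalize.
Qed.

(** In dimension 0 the unit sphere is empty and the norm is the supremum of the
empty set. *)
Lemma opnorm_ge0 : 0 <= opnorm A.
Proof.
have [[v v1]|no] := pselect (exists v : 'rV[R]_d, enorm v = 1).
  by have := enorm_opnorm v; rewrite v1 mulr1; exact/le_trans/enorm_ge0.
rewrite /opnorm (_ : image _ _ = set0) ?sup0// -subset0 => _ [v /= v1 _].
by apply: no; exists v.
Qed.

Lemma bilin_opnorm_ge0 : 0 <= bilin_opnorm (fun v w => B v w).
Proof.
have [[v v1]|no] := pselect (exists v : 'rV[R]_d, enorm v = 1).
  have := enorm_bilin_opnorm v v; rewrite v1 !mulr1; exact/le_trans/enorm_ge0.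
rewrite /bilin_opnorm (_ : image _ _ = set0) ?sup0// -subset0.
by move=> _ [p /= [p1 _] _]; apply: no; exists p.1.
Qed.

Variables (f : 'rV[R]_d) (r : R).
Local Notation F := (vfield A B f).

Lemma a_max_ge0 : 0 <= r -> 0 <= a_max A B r.
Proof.
by move=> r0; rewrite /a_max addr_ge0 ?opnorm_ge0// !mulr_ge0 ?bilin_opnorm_ge0.
Qed.

Lemma v_max_ge0 : 0 <= r -> 0 <= v_max A B f r.
Proof.
move=> r0; rewrite /v_max !addr_ge0 ?enorm_ge0//.
  by rewrite mulr_ge0 ?opnorm_ge0.
by rewrite mulr_ge0 ?bilin_opnorm_ge0// sqr_ge0.
Qed.

Lemma enorm_vfield v : eball r v -> enorm (F v) <= v_max A B f r.
Proof.
rewrite /eball/= => vr; rewrite /vfield /v_max.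
have r0 : 0 <= r by exact: le_trans (enorm_ge0 v) vr.
rewrite (le_trans (ler_enormD _ _))// lerD2r (le_trans (ler_enormD _ _))//.
rewrite !enormN lerD//.
  by rewrite (le_trans (enorm_opnorm v))// ler_wpM2l// opnorm_ge0.
rewrite (le_trans (enorm_bilin_opnorm v v))// expr2 mulrA.
by rewrite ler_pM ?mulr_ge0 ?enorm_ge0 ?bilin_opnorm_ge0// ler_wpM2l// bilin_opnorm_ge0.
Qed.

(** The quadratic part is handled by
B(v, v) - B(w, w) = B(v - w, v) + B(w, v - w), whence the factor 2 r ||B||. *)
Lemma vfield_lipschitz v w : eball r v -> eball r w ->
  enorm (F v - F w) <= a_max A B r * enorm (v - w).
Proof.
rewrite /eball/= => vr wr; set K := bilin_opnorm (fun v w => B v w).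
have K0 : 0 <= K by exact: bilin_opnorm_ge0.
have -> : F v - F w = - A (v - w) - (B (v - w) v + B w (v - w)).
  rewrite /vfield !(linearBr, linearBl, linearB)/=.
  by apply/rowP => i; rewrite !mxE; ring.
rewrite (le_trans (ler_enormD _ _))// !enormN /a_max -/K mulrDl.
rewrite lerD ?enorm_opnorm// (le_trans (ler_enormD _ _))//.
have h1 := enorm_bilin_opnorm (v - w) v.
have h2 := enorm_bilin_opnorm w (v - w).
have : K * enorm (v - w) * enorm v <= K * enorm (v - w) * r.
  by rewrite ler_wpM2l// mulr_ge0// enorm_ge0.
have : K * enorm w * enorm (v - w) <= K * r * enorm (v - w).
  by rewrite ler_wpM2r ?enorm_ge0// ler_wpM2l.
rewrite -/K in h1 h2; nra.
Qed.

End operator_norms.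

(** * Trajectories of a vector field *)

Lemma within_itvcc {R : realType} {U : topologicalType} (x : R -> U) (a b : R) : 0 <= a ->
  {within `[0, +oo[, continuous x} -> {within `[a, b], continuous x}.
Proof.
move=> a0; apply: continuous_subspaceW => t /=; rewrite !in_itv/= andbT.
by move=> /andP[+ _]; exact: le_trans.
Qed.

Section row_vector_paths.
Context {R : realType} {d : nat}.
Implicit Types (x y : R -> 'rV[R]_d) (l : 'rV[R]_d) (t s : R) (S : set R).

Lemma is_derive_coord x t l j :
  is_derive t 1 x l -> is_derive t 1 (fun s => x s 0 j) (l 0 j).
Proof.
move=> [dx <-]; apply: DeriveDef; first by move/derivable_mxP : dx; exact.
by rewrite derive_mx// mxE.
Qed.

Lemma is_derive_row x t l :
  (forall j, is_derive t 1 (fun s => x s 0 j) (l 0 j)) -> is_derive t 1 x l.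
Proof.
move=> dx; have dvx : derivable x t 1.
  by apply/derivable_mxP => i j; rewrite ord1; have [] := dx j.
apply: DeriveDef => //; apply/rowP => j; rewrite derive_mx// mxE.
exact: derive_val.
Qed.

Lemma is_derive_shiftl x t s l :
  is_derive (s + t) 1 x l -> is_derive t 1 (fun a => x (s + a)) l.
Proof.
move=> dx; apply: is_derive_row => j.
rewrite -[l 0 j]mulr1.
apply: (@is_derive1_comp _ (fun a => x a 0 j) (fun a => s + a)).
  exact: is_derive_coord.
rewrite (_ : (fun a => s + a) = (shift s : R -> R)).
  exact: is_derive_shift.
by apply/funext => a; rewrite /= addrC.
Qed.

Lemma is_derive_dotp x y t lx ly :
  is_derive t 1 x lx -> is_derive t 1 y ly ->
  is_derive t 1 (fun s => dotp (x s) (y s)) (dotp lx (y t) + dotp (x t) ly).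
Proof.
move=> dx dy; rewrite (_ : (fun s => _) = \sum_(i < d) (fun s => x s 0 i * y s 0 i)).
  rewrite /dotp -big_split/=; apply: is_derive_sum => i.
  rewrite addrC (mulrC (lx 0 i)).
  by apply: is_deriveM; exact: is_derive_coord.
by apply/funext => s; rewrite fct_sumE.
Qed.

Lemma is_derive_dotpl x t l e :
  is_derive t 1 x l -> is_derive t 1 (fun s => dotp (x s) e) (dotp l e).
Proof.
move=> dx; have -> : dotp l e = dotp l e + dotp (x t) 0.
  by rewrite [X in _ + X]/dotp big1 ?addr0// => i _; rewrite mxE mulr0.
exact: (@is_derive_dotp x (cst e)).
Qed.

Lemma within_continuous_dotp S x y :
  {within S, continuous x} -> {within S, continuous y} ->
  {within S, continuous (fun s => dotp (x s) (y s))}.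
Proof.
move=> cx cy t; apply: cvg_big => [|i _]; first exact: add_continuous.
  apply: cvgM.
  apply: (@continuous_comp (subspace S) _ _ x (fun M => M 0 i) t (cx t)).
  exact: coord_continuous.
apply: (@continuous_comp (subspace S) _ _ y (fun M => M 0 i) t (cy t)).
exact: coord_continuous.
Qed.

End row_vector_paths.

Section trajectories.
Context {R : realType} {d : nat}.
Implicit Types (F : 'rV[R]_d -> 'rV[R]_d) (x y : R -> 'rV[R]_d)
  (a b s t : R).

(** At time 0 only continuity from the right is asked, since a solution map says
nothing about negative times. *)
Definition trajectory F x : Prop :=
  {within `[0, +oo[, continuous x} /\
  forall t : R, 0 < t -> is_derive t 1 x (F (x t)).

Lemma trajectory_shift F x s : 0 <= s -> trajectory F x ->
  trajectory F (fun t => x (s + t)).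
Proof.
rewrite le_eqVlt => /predU1P[<- xt|s0 [cx dx]].
  by rewrite (_ : (fun t => _) = x)//; apply/funext => t; rewrite add0r.
have dxs (t : R) : 0 <= t -> is_derive t 1 (fun t => x (s + t)) (F (x (s + t))).
  by move=> t0; apply: is_derive_shiftl; apply: dx; rewrite ltr_wpDr.
split; last by move=> t /ltW; exact: dxs.
apply: continuous_in_subspaceT => t; rewrite inE/= in_itv/= andbT => /dxs[+ _].
by move/derivable1_diffP/differentiable_continuous.
Qed.

(** The mean value theorem fails for vector-valued paths; testing against a fixed
vector e gives the form in which it holds, with a point c depending on e. *)
Lemma trajectory_MVT F x a b e : trajectory F x -> 0 <= a -> a < b ->
  exists2 c, a < c < b & dotp (x b - x a) e = (b - a) * dotp (F (x c)) e.
Proof.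
move=> [cx dx] a0 ab.
have [c| |c cab cE] := @MVT R (fun s => dotp (x s) e) (fun s => dotp (F (x s)) e) _ _ ab.
- move=> cab; apply: is_derive_dotpl; apply: dx.
  by move: cab; rewrite in_itv/= => /andP[+ _]; exact: le_lt_trans.
- apply: (@within_continuous_dotp _ _ _ x (cst e)); first exact: within_itvcc.
  by apply: continuous_subspaceT => ?; exact: cvg_cst.
by exists c; [move: cab; rewrite in_itv|rewrite dotpBl cE mulrC].
Qed.

(** If the path were outside the ball at time t0, look at the last time s <= t0 at
which it is inside.  Right after s it is in the shell of width delta, where the
squared norm has nonpositive derivative, so it cannot have left the ball. *)
Lemma trajectory_ball F x (r delta : R) : 0 < r -> 0 < delta ->
  (forall v, r <= enorm v <= r + delta -> dotp (F v) v <= 0) ->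
  trajectory F x -> eball r (x 0) -> forall t, 0 <= t -> eball r (x t).
Proof.
move=> r0 delta0 trap [cx dx]; rewrite /eball /= => x0r t0 t00.
rewrite leNgt; apply/negP => xt0.
have r_ge0 := ltW r0.
pose g s := dotp (x s) (x s).
have cg : {within `[0, +oo[, continuous g} by exact: within_continuous_dotp.
have cgP s (e : R) : 0 <= s -> 0 < e ->
    exists2 eta : R, 0 < eta & forall z : R, 0 <= z -> `|s - z| < eta -> `|g s - g z| < e.
  move=> s0 e0; have /subspace_continuousP/(_ s) := cg.
  rewrite /= in_itv/= andbT => /(_ s0)/cvgrPdist_lt/(_ _ e0).
  move=> [eta /= eta0 H]; exists eta => // z z0 sz.
  by apply: H => //=; rewrite in_itv/= andbT.
have gE s : (enorm (x s) <= r) = (g s <= r ^+ 2).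
  by rewrite -ler_sqr ?nnegrE ?enorm_ge0// enorm_sqr.
pose E := [set s : R | 0 <= s <= t0 /\ g s <= r ^+ 2].
have E0 : E 0 by rewrite /E/= lexx t00 -gE.
have Eub : ubound E t0 by move=> s [/andP[]].
have supE : has_sup E by split; [exists 0|exists t0].
pose s := sup E.
have s0 : 0 <= s by apply: ub_le_sup => //; exists t0.
have st0 : s <= t0 by apply: ge_sup => //; exists 0.
have gs : g s <= r ^+ 2.
  rewrite leNgt; apply/negP => gs.
  have [|eta eta0 etaP] := @cgP s (g s - r ^+ 2) s0; first by rewrite subr_gt0.
  have [z Ez sz] := sup_adherent eta0 supE.
  have zs : z <= s by apply: ub_le_sup => //; exists t0.
  have [/andP[z0 _] gz] := Ez.
  have := etaP _ z0; rewrite ger0_norm ?subr_ge0// ltrBlDl -ltrBlDr => /(_ sz).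
  by rewrite ltr_norml => /andP[_]; rewrite ltrD2l ltrN2 ltNge gz.
(* s is a supremum, so the path is strictly outside the ball after s. *)
have gt s' : s < s' -> s' <= t0 -> r ^+ 2 < g s'.
  move=> ss' s't0; rewrite ltNge; apply/negP => gs'.
  have : s' <= s.
    apply: ub_le_sup; first by exists t0.
    by split=> //; rewrite s't0 (le_trans s0 (ltW ss')).
  by rewrite leNgt ss'.
have st0' : s < t0.
  rewrite lt_neqAle st0 andbT; apply/eqP => st0E.
  by move: xt0; rewrite ltNge gE -st0E gs.
have rd : r ^+ 2 < (r + delta) ^+ 2 by nra.
have [|eta eta0 etaP] := @cgP s ((r + delta) ^+ 2 - r ^+ 2) s0.
  by rewrite subr_gt0.
(* Halving eta keeps the interval ]s, b] inside the open neighbourhood of s. *)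
pose b := Num.min t0 (s + eta / 2).
have sb : s < b by rewrite /b lt_min st0' ltrDl divr_gt0.
have bt0 : b <= t0 by rewrite /b ge_min lexx.
have bs : b <= s + eta / 2 by rewrite /b ge_min lexx orbT.
have [c cab| |c cab cE] :=
    @MVT R g (fun t => dotp (F (x t)) (x t) + dotp (x t) (F (x t))) s b sb.
- have c0 : 0 < c by apply: le_lt_trans s0 _; rewrite (itvP cab).
  by apply: is_derive_dotp; exact: dx.
- exact: within_itvcc.
have {cab}[sc cb] : s < c /\ c < b by rewrite !(itvP cab).
have gc : r ^+ 2 < g c by apply: gt => //; lra.
have gc' : g c < (r + delta) ^+ 2.
  have : `|g s - g c| < (r + delta) ^+ 2 - r ^+ 2.
    by apply: etaP; [lra|rewrite ltr0_norm ?subr_lt0//; lra].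
  by rewrite ltr_norml => /andP[]; lra.
have Fc : dotp (F (x c)) (x c) <= 0.
  apply: trap; apply/andP; split.
    by rewrite -ler_sqr ?nnegrE ?enorm_ge0// enorm_sqr ltW.
  by rewrite -ler_sqr ?nnegrE ?enorm_ge0 ?addr_ge0 ?(ltW delta0)// enorm_sqr ltW.
have := gt b sb bt0; rewrite (dotpC (x c)) in cE; nra.
Qed.

(** The function |x - y|^2 exp(- 2 L t) is nonincreasing. *)
Lemma trajectory_gronwall F x y (r L : R) :
  (forall v w, eball r v -> eball r w ->
     enorm (F v - F w) <= L * enorm (v - w)) ->
  trajectory F x -> trajectory F y ->
  (forall t, 0 <= t -> eball r (x t)) -> (forall t, 0 <= t -> eball r (y t)) ->
  forall t, 0 <= t -> enorm (x t - y t) <= expR (L * t) * enorm (x 0 - y 0).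
Proof.
move=> lip [cx dx] [cy dy] xr yr t; rewrite le_eqVlt => /predU1P[<-|t0].
  by rewrite mulr0 expR0 mul1r.
pose z s := x s - y s.
pose g s := dotp (z s) (z s) * expR (- (2 * L) * s).
have cz : {within `[0, +oo[, continuous z}.
  by move=> s; apply: cvgB; [exact: cx|exact: cy].
have cexp : continuous (fun s : R => expR (- (2 * L) * s)).
  move=> s; apply: (@continuous_comp _ _ _ ( *%R (- (2 * L)))).
    exact: mulrl_continuous.
  exact: continuous_expR.
pose dz s := F (x s) - F (y s).
have [c cab| |c cab cE] := @MVT R g
  (fun s => expR (- (2 * L) * s) * (2 * (dotp (dz s) (z s) - L * dotp (z s) (z s))))
  0 t t0.
- have c0 : 0 < c by rewrite (itvP cab).
  have dzc : is_derive c 1 z (dz c) by apply: is_deriveB; [exact: dx|exact: dy].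
  have dexp : is_derive c 1 (fun s : R => expR (- (2 * L) * s))
      (expR (- (2 * L) * c) * (- (2 * L))).
    apply: (@is_derive1_comp _ expR ( *%R (- (2 * L)))).
    rewrite -[X in is_derive _ _ _ X]mulr1.
    exact: (@is_deriveZ _ _ _ id (- (2 * L)) c 1 1).
  have := is_deriveM (is_derive_dotp dzc dzc) dexp.
  congr (is_derive _ _ _ _); rewrite (dotpC (z c) (dz c)) /GRing.scale/=.
  by ring.
- move=> s; apply: cvgM.
    exact: (within_itvcc (lexx 0) (within_continuous_dotp cz cz)).
  exact: (continuous_subspaceT cexp).
have c0 : 0 <= c by rewrite (itvP cab).
have dzc : dotp (dz c) (z c) <= L * dotp (z c) (z c).
  rewrite (le_trans (dotp_le_enorm _ _))// -enorm_sqr expr2 mulrA.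
  by rewrite ler_wpM2r ?enorm_ge0// lip//; [exact: xr|exact: yr].
have gt0 : g t <= g 0.
  rewrite -subr_le0 cE subr0 mulr_le0_ge0 ?(ltW t0)// mulr_ge0_le0 ?expR_ge0//.
  by rewrite mulr_ge0_le0// subr_le0.
rewrite -ler_sqr ?nnegrE ?mulr_ge0 ?expR_ge0 ?enorm_ge0// exprMn.
rewrite -expRM_natl !enorm_sqr.
move: gt0; rewrite /g mulr0 expR0 mulr1 -ler_pdivlMr ?expR_gt0// -expRN.
by rewrite mulNr opprK mulrC mulrA.
Qed.

End trajectories.

(** * Nested compact sets *)

Section distance_to_a_set.
Context {R : realType} {d : nat}.
Implicit Types (v w : 'rV[R]_d) (S : set 'rV[R]_d).

Lemma dist_to_le v w S : S w -> dist_to v S <= enorm (v - w).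
Proof.
move=> Sw; apply: ge_inf; last by exists w.
by exists 0 => _ [w' _ <-]; exact: enorm_ge0.
Qed.

Lemma dist_to_ge0 v S : 0 <= dist_to v S.
Proof.
have [->|/set0P[w Sw]] := eqVneq S set0; first by rewrite /dist_to image_set0 inf0.
apply: lb_le_inf; first by exists (enorm (v - w)); exists w.
by move=> _ [? _ <-]; exact: enorm_ge0.
Qed.

Lemma closed_rV S :
  (forall p, (forall e : R, 0 < e -> exists2 v, S v & enorm (p - v) <= e) -> S p) ->
  closed S.
Proof.
move=> H p clp; apply: H => e e0.
have sd : 0 < Num.sqrt (d%:R : R) + 1 by rewrite ltr_wpDl// sqrtr_ge0.
have [|v [Sv pv]] := clp (ball p (e / (Num.sqrt d%:R + 1))).
  by apply: nbhsx_ballx; rewrite divr_gt0.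
exists v => //; move: pv; rewrite -ball_normE /ball_/= => /ltW pv.
rewrite (le_trans (enorm_le_norm _))//.
rewrite (@le_trans _ _ ((Num.sqrt d%:R + 1) * `|p - v|))//.
  by rewrite ler_wpM2r// lerDl.
by rewrite mulrC -ler_pdivlMr.
Qed.

Lemma bounded_eball (r : R) : bounded_set (@eball R d r).
Proof.
exists r; split; first exact: num_real.
move=> x rx v /= vr; rewrite (le_trans (norm_le_enorm _))// (le_trans vr)//.
exact: ltW.
Qed.

(** Otherwise there are points v_k of K_k at distance at least e from S.  A cluster
point of this bounded sequence lies in every K_k, hence in S, although some v_k
is arbitrarily close to it. *)
Lemma nested_compact_dist (K : nat -> set 'rV[R]_d) S :
  (forall k, closed (K k)) -> bounded_set (K 0%N) ->
  (forall k l, (k <= l)%N -> K l `<=` K k) -> \bigcap_k K k `<=` S ->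
  forall e : R, 0 < e -> exists N, forall v, K N v -> dist_to v S < e.
Proof.
move=> clK bK decK KS e e0; apply: contrapT => /forallNP noN.
have /choice[v vP] : forall k, exists v, K k v /\ e <= dist_to v S.
  move=> k; have /existsNP[v /not_implyP[Kv /negP]] := noN k.
  by rewrite -leNgt; exists v.
have [p [_ vp]] : K 0%N `&` cluster (v @ \oo) !=set0.
  apply: (bounded_closed_compact bK (clK 0%N)).
  by exists 0%N => // n _; apply: (decK 0%N n) => //; exact: (vP n).1.
have Kp k : K k p.
  apply: clK => B pB; apply: vp => //.
  by exists k => // n kn; apply: (decK k n) => //; exact: (vP n).1.
have Sp : S p by exact: KS.
have sd : 0 < Num.sqrt (d%:R : R) + 1 by rewrite ltr_wpDl// sqrtr_ge0.
have [||w [/= [n _ <-] pw]] := vp (range v) (ball p (e / (Num.sqrt d%:R + 1))).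
- by exists 0%N => // n _; exists n.
- by apply: nbhsx_ballx; rewrite divr_gt0.
have := (vP n).2; rewrite leNgt => /negP; apply.
rewrite (le_lt_trans (dist_to_le _ Sp))//; move: pw.
rewrite -ball_normE /ball_/= distrC => pw.
rewrite (le_lt_trans (enorm_le_norm _))//.
rewrite (@le_lt_trans _ _ ((Num.sqrt d%:R + 1) * `|v n - p|))//.
  by rewrite ler_wpM2r// lerDl.
by rewrite mulrC -ltr_pdivlMr.
Qed.

End distance_to_a_set.

(** * The flow inside the trapping ball *)

Section trapped_flow.
Context {R : realType} {d : nat}.
Variables (A : {linear 'rV[R]_d -> 'rV[R]_d})
  (B : {bilinear 'rV[R]_d -> 'rV[R]_d -> 'rV[R]_d}) (f : 'rV[R]_d).
Variables (r : R) (Psi : R -> 'rV[R]_d -> 'rV[R]_d).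
Hypotheses (r_gt0 : 0 < r) (trap : trapping_ball A B f r).
Hypothesis Psi_sol : solution_map (vfield A B f) r Psi.
Implicit Types (v w : 'rV[R]_d) (s t : R).
Local Notation F := (vfield A B f).
Local Notation a := (a_max A B r).
Local Notation vm := (v_max A B f r).

Lemma flow0 v : eball r v -> Psi 0 v = v.
Proof. by move=> /Psi_sol[]. Qed.

Lemma flow_trajectory v : eball r v -> trajectory F (Psi^~ v).
Proof. by move=> /Psi_sol[]. Qed.

Lemma flow_ball v t : eball r v -> 0 <= t -> eball r (Psi t v).
Proof.
move=> vr; have [delta delta0 Htrap] := trap.
apply: (trajectory_ball r_gt0 delta0 Htrap (flow_trajectory vr)).
by rewrite flow0.
Qed.

Lemma flow_lipschitz v w t : eball r v -> eball r w -> 0 <= t ->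
  enorm (Psi t v - Psi t w) <= expR (a * t) * enorm (v - w).
Proof.
move=> vr wr t0; rewrite -[in leRHS](flow0 vr) -[in leRHS](flow0 wr).
apply: (trajectory_gronwall (@vfield_lipschitz _ _ A B f r)
  (flow_trajectory vr) (flow_trajectory wr)) => // s; exact: flow_ball.
Qed.

(** Uniqueness of solutions: both sides are trajectories in t which start from the
same point, so Gronwall bounds their distance by 0. *)
Lemma flowD v s t : eball r v -> 0 <= s -> 0 <= t ->
  Psi (s + t) v = Psi t (Psi s v).
Proof.
move=> vr s0 t0; have vsr := flow_ball vr s0.
apply/eqP; rewrite -subr_eq0 -enorm_eq0 eq_le enorm_ge0 andbT.
have := trajectory_gronwall (@vfield_lipschitz _ _ A B f r)
  (trajectory_shift s0 (flow_trajectory vr)) (flow_trajectory vsr) _ _ t0.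
rewrite addr0 flow0// subrr enorm0 mulr0; apply => t' t'0; apply: flow_ball => //.
by rewrite addr_ge0.
Qed.

(** The mean value theorem is applied in the direction of the displacement itself,
which gives a Euclidean bound without a factor depending on the dimension. *)
Lemma flow_speed v s t : eball r v -> 0 <= s -> s <= t ->
  enorm (Psi t v - Psi s v) <= (t - s) * vm.
Proof.
move=> vr s0; rewrite le_eqVlt => /predU1P[<-|st].
  by rewrite !subrr enorm0 mul0r.
set D := Psi t v - Psi s v.
have [D0|D0] := eqVneq (enorm D) 0.
  by rewrite D0 mulr_ge0 ?v_max_ge0 ?subr_ge0 ?ltW.
have {}D0 : 0 < enorm D by rewrite lt_def D0 enorm_ge0.
have [c /andP[sc ct] cE] := trajectory_MVT D (flow_trajectory vr) s0 st.
rewrite -(ler_pM2r D0) -expr2 enorm_sqr cE -mulrA ler_wpM2l ?subr_ge0 ?(ltW st)//.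
rewrite (le_trans (dotp_le_enorm _ _))// ler_wpM2r ?(ltW D0)// enorm_vfield//.
by apply: flow_ball => //; lra.
Qed.

(** A trajectory is straight up to an error quadratic in time.  The velocity may be
taken at any intermediate time c; both endpoints are used below, for displacements
forward and backward in time. *)
Lemma flow_displacement v s t c j : eball r v -> 0 <= s -> s <= c -> c <= t ->
  `|(Psi t v - Psi s v) 0 j - (t - s) * F (Psi c v) 0 j| <= a * vm * (t - s) ^+ 2.
Proof.
move=> vr s0 sc ct; have := le_trans sc ct.
rewrite le_eqVlt => /predU1P[st|st].
  by rewrite -st !subrr mul0r mxE subr0 normr0 expr0n mulr0.
have [x /andP[sx xt]] := trajectory_MVT (delta_mx 0 j) (flow_trajectory vr) s0 st.
rewrite !dotp_delta => ->.
have st0 : 0 <= t - s by lra.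
have xr : eball r (Psi x v) by apply: flow_ball => //; lra.
have cr : eball r (Psi c v) by apply: flow_ball => //; lra.
have a0 : 0 <= a by rewrite a_max_ge0// ltW.
have v0 : 0 <= vm by rewrite v_max_ge0// ltW.
rewrite -mulrBr normrM ger0_norm// expr2 mulrCA ler_wpM2l//.
have -> : F (Psi x v) 0 j - F (Psi c v) 0 j = (F (Psi x v) - F (Psi c v)) 0 j.
  by rewrite !mxE.
rewrite (le_trans (coord_le_enorm _ _))// (le_trans (vfield_lipschitz _ _ _ xr cr))//.
rewrite -mulrA ler_wpM2l//; case/orP : (le_total c x) => cx.
  apply: le_trans (flow_speed vr (le_trans s0 sc) cx) _.
  by rewrite mulrC ler_wpM2l//; lra.
rewrite -opprB enormN; apply: le_trans (flow_speed vr (le_trans s0 (ltW sx)) cx) _.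
by rewrite mulrC ler_wpM2l//; lra.
Qed.

End trapped_flow.

(** * Summable sequences and infinite products *)

Section summable_sequences.
Context {R : realType}.
Implicit Type g : nat -> R.

Lemma summable_tail g (e : R) : (forall i, 0 <= g i) ->
  (\sum_(0 <= i <oo) (g i)%:E < +oo)%E -> 0 < e ->
  exists N, forall n, \sum_(N <= i < n) g i <= e.
Proof.
move=> g0 gfin e0.
have gE0 k : true -> (0 <= (g k)%:E)%E by rewrite lee_fin.
have /fine_cvgP[[N1 _ fin1] /cvgrPdist_lt/(_ _ e0)[N2 _ lt2]] :=
  nneseries_tail_cvg gfin gE0.
exists (maxn N1 N2) => n.
have := lt2 (maxn N1 N2) (leq_maxr _ _).
rewrite /= sub0r normrN => /(le_lt_trans (ler_norm _))/ltW.
apply: le_trans; rewrite -lee_fin -sumEFin fineK; last exact: fin1 (leq_maxl _ _).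
by apply: nneseries_lim_ge => k _ _; rewrite lee_fin.
Qed.

Lemma summable_term_small g (e : R) : (forall i, 0 <= g i) ->
  (\sum_(0 <= i <oo) (g i)%:E < +oo)%E -> 0 < e ->
  exists N, forall i, (N <= i)%N -> g i <= e.
Proof.
move=> g0 gfin e0; have [N NP] := summable_tail g0 gfin e0; exists N => i Ni.
apply: le_trans (NP i.+1); rewrite big_nat_recr//= lerDr.
by rewrite sumr_ge0.
Qed.

Lemma prod_one_sub_ge g m n : (forall i, 0 <= g i <= 1) ->
  1 - \sum_(m <= i < n) g i <= \prod_(m <= i < n) (1 - g i).
Proof.
move=> g01.
suff /andP[] : 1 - \sum_(m <= i < n) g i <= \prod_(m <= i < n) (1 - g i) <= 1 by [].
elim/big_rec2 : _ => [|i y x _ /andP[h1 h2]]; first by rewrite subr0 lexx.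
by have [g0 g1] := andP (g01 i); apply/andP; split; nra.
Qed.

(** Beyond an index N where the tail of the sum is at most 1/2, the factors multiply
to at least 1/2 by Weierstrass' inequality; the finitely many factors before N are
positive. *)
Lemma prod_one_sub_bounded_below g : (forall i, 0 <= g i < 1) ->
  (\sum_(0 <= i <oo) (g i)%:E < +oo)%E ->
  exists2 c, 0 < c & forall n, c <= \prod_(0 <= i < n) (1 - g i).
Proof.
move=> g01 gfin; have g0 i : 0 <= g i by have /andP[] := g01 i.
have g1 i : 0 < 1 - g i by rewrite subr_gt0; have /andP[] := g01 i.
have prod_gt0 m n : 0 < \prod_(m <= i < n) (1 - g i) by rewrite prodr_gt0.
have [|N NP] := @summable_tail g 2^-1 g0 gfin; first by rewrite invr_gt0.
exists ((\prod_(0 <= i < N) (1 - g i)) / 2); first by rewrite divr_gt0.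
move=> n; have [Nn|/ltnW nN] := leqP N n.
  rewrite (big_cat_nat (leq0n N) Nn)/= ler_pM2l//.
  apply: le_trans (prod_one_sub_ge _ _ _).
    by have := NP n; lra.
  by move=> i; rewrite g0/= ltW//; have /andP[] := g01 i.
rewrite (big_cat_nat (leq0n n) nN)/= -mulrA ger_pMr//.
have : \prod_(n <= i < N) (1 - g i) <= 1.
  by rewrite prodr_ile1// => i _; rewrite ltW//= gerBl.
by have := prod_gt0 n N; lra.
Qed.

End summable_sequences.

(** * Separation of the points of the tube from the leaf *)

Section leaf_separation.
Context {R : realType} {d : nat}.
Variables (A : {linear 'rV[R]_d -> 'rV[R]_d})
  (B : {bilinear 'rV[R]_d -> 'rV[R]_d -> 'rV[R]_d}) (f : 'rV[R]_d).
Variables (r : R) (Psi : R -> 'rV[R]_d -> 'rV[R]_d).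
Hypotheses (r_gt0 : 0 < r) (trap : trapping_ball A B f r).
Hypothesis Psi_sol : solution_map (vfield A B f) r Psi.
Variables (h eps : R).
Hypotheses (h_gt0 : 0 < h) (eps_gt0 : 0 < eps).
Variable u : 'rV[R]_d.
Hypothesis u_ball : eball r u.
Implicit Types (v w : 'rV[R]_d) (t : R) (Y : nat -> 'rV[R]_d).
Local Notation F := (vfield A B f).
Local Notation a := (a_max A B r).
Local Notation vm := (v_max A B f r).
Local Notation obs i v := (Psi (obs_time h i) v).
Local Notation U := (cropped_leaf Psi r h eps u).

Lemma obs_time_ge0 i : 0 <= obs_time h i.
Proof. by rewrite mulr_ge0// ltW. Qed.

(** The support of the smoothing density is this set without the zeros of the prior.
Adding them back makes the set compact. *)
Definition consistent Y (k : nat) : set 'rV[R]_d :=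
  [set v | eball r v /\ forall i, (i <= k)%N -> `|Y i - obs i v| <= eps].

Lemma closed_consistent Y k : closed (consistent Y k).
Proof.
apply: closed_rV => p pK.
have pr : eball r p.
  apply/ler_addgt0Pr => e e0; have [v [/= vr _] pv] := pK e e0.
  by rewrite -(subrK v p) (le_trans (ler_enormD _ _))// addrC lerD.
split=> // i ik; apply/ler_addgt0Pr => e e0.
have [|v [vr vY] pv] := pK (e / expR (a * obs_time h i)).
  by rewrite divr_gt0// expR_gt0.
rewrite -(subrKA (obs i v)) (le_trans (ler_normD _ _))// lerD ?vY//.
rewrite distrC (le_trans (norm_le_enorm _))//.
rewrite (le_trans (flow_lipschitz r_gt0 trap Psi_sol pr vr (obs_time_ge0 i)))//.
by rewrite mulrC -ler_pdivlMr ?expR_gt0.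
Qed.

Lemma consistent_dist Y : \bigcap_k consistent Y k `<=` U ->
  forall e : R, 0 < e -> exists N, forall v, consistent Y N v -> dist_to v U < e.
Proof.
move=> KU e e0; apply: (@nested_compact_dist _ _ (consistent Y)) => //.
- exact: closed_consistent.
- have [M [Mr MP]] := @bounded_eball R d r; exists M; split=> // x Mx v [vr _].
  exact: MP vr.
- by move=> k l kl v [vr vY]; split=> // i ik; apply: vY; exact: leq_trans kl.
Qed.

Lemma cropped_leaf_gap v (e : R) : U v -> 0 < e ->
  exists N, forall i, (N <= i)%N -> obs_gap Psi h u v i <= e.
Proof. by move=> [_ + _]; apply: summable_term_small => i; exact: normr_ge0. Qed.

Lemma cropped_leaf_refl : U u.
Proof.
have gap0 i : obs_gap Psi h u u i = 0 by rewrite /obs_gap subrr normr0.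
split=> //; first by rewrite eseries0// => i _; rewrite gap0.
apply: (@le_lt_trans _ _ 0%E); last by rewrite lte_fin mulr_gt0.
by apply: ge_ereal_sup => _ [i _ <-]; rewrite gap0.
Qed.

(** For t < 0 it is w that lies on the trajectory of v, so the velocity at w is the one
at the end of the time interval. *)
Lemma leaf_displacement v w t i j : eball r v -> eball r w ->
  (0 <= t /\ Psi t w = v) \/ (t < 0 /\ Psi (- t) v = w) ->
  `|(obs i v - obs i w) 0 j - t * F (obs i w) 0 j| <= a * vm * t ^+ 2.
Proof.
move=> vr wr; have ti0 := obs_time_ge0 i.
have fD := flowD r_gt0 trap Psi_sol.
have dsp := flow_displacement r_gt0 trap Psi_sol.
case=> [[t0 vE]|[t0 wE]].
  have -> : obs i v = Psi (obs_time h i + t) w by rewrite addrC fD// vE.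
  have := @dsp w (obs_time h i) (obs_time h i + t) (obs_time h i) j wr ti0.
  by rewrite addrAC subrr add0r lexx lerDl => /(_ isT t0).
have -> : obs i w = Psi (obs_time h i - t) v.
  by rewrite addrC fD// ?wE// oppr_ge0 ltW.
have := @dsp v (obs_time h i) (obs_time h i - t) (obs_time h i - t) j vr ti0.
rewrite (addrAC _ (- t)) subrr add0r lexx lerDl oppr_ge0 sqrrN => /(_ (ltW t0) isT).
set w' := Psi (obs_time h i - t) v; set v' := Psi (obs_time h i) v.
by rewrite -normrN; congr (`|_| <= _); rewrite !mxE; ring.
Qed.

Variable v_min : R.
Hypothesis v_min_gt0 : 0 < v_min.

(** Along the observation times, v_i - u_i is close to t F(u_i): the error has three
parts, the curvature of the trajectory from w_i to v_i, the difference of the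
velocities at w_i and u_i, and w_i - u_i itself.  Each is eventually at most a sixth
of |t| v_min, the first by the smallness of t and the other two because the gaps
between w and u tend to 0. *)
Lemma leaf_separation v w t : eball r v -> U w -> t != 0 ->
  6 * (a * vm) * `|t| <= v_min ->
  (0 <= t /\ Psi t w = v) \/ (t < 0 /\ Psi (- t) v = w) ->
  exists N, forall i j, (N <= i)%N -> v_min <= `|F (obs i u) 0 j| ->
    `|t| * (v_min / 2) <=
      Num.sg t * Num.sg (F (obs i u) 0 j) * (obs i v - obs i u) 0 j.
Proof.
move=> vr Uw t0 tsmall vw; have wr : eball r w by case: Uw.
have a0 : 0 <= a by rewrite a_max_ge0// ltW.
have tt0 : 0 < `|t| by rewrite normr_gt0.
(* The gap is a sup norm and the Lipschitz bound on F is Euclidean, hence the factor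
   sqrt d; adding 1 makes s positive, so that one may divide by it. *)
pose s : R := a * Num.sqrt d%:R + 1.
have s0 : 0 < s by rewrite ltr_wpDl// mulr_ge0// sqrtr_ge0.
pose e := Num.min (`|t| * v_min / 6) (v_min / 6 / s).
have e0 : 0 < e by rewrite lt_min !divr_gt0// mulr_gt0.
have [N NP] := cropped_leaf_gap Uw e0.
exists N => i j Ni Fu.
have := NP i Ni; rewrite /obs_gap /e le_min => /andP[gap1 gap2].
have := leaf_displacement i j vr wr vw.
have wu : `|(obs i w - obs i u) 0 j| <= `|t| * v_min / 6.
  exact: le_trans (coord_le_norm _ _) gap1.
have Fwu : `|F (obs i w) 0 j - F (obs i u) 0 j| <= v_min / 6.
  have -> : F (obs i w) 0 j - F (obs i u) 0 j = (F (obs i w) - F (obs i u)) 0 j.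
    by rewrite !mxE.
  rewrite (le_trans (coord_le_enorm _ _))//.
  have obr x : eball r x -> eball r (obs i x).
    by move=> xr; apply: (flow_ball r_gt0 trap Psi_sol) => //; exact: obs_time_ge0.
  rewrite (le_trans (vfield_lipschitz _ _ _ (obr _ wr) (obr _ u_ball)))//.
  apply: (@le_trans _ _ (s * `|obs i w - obs i u|)).
    rewrite [leRHS]mulrDl mul1r -mulrA -[leLHS]addr0 lerD// ler_wpM2l//.
    exact: enorm_le_norm.
  by rewrite mulrC -ler_pdivlMr.
have -> : (obs i v - obs i u) 0 j =
    (obs i v - obs i w) 0 j + (obs i w - obs i u) 0 j by rewrite !mxE; ring.
move: wu Fwu Fu.
move: ((obs i v - obs i w) 0 j) ((obs i w - obs i u) 0 j) => x z.
move: (F (obs i w) 0 j) (F (obs i u) 0 j) => Fw Fu.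
have : a * vm * t ^+ 2 <= `|t| * v_min / 6.
  by rewrite -real_normK ?num_real//; nra.
move: (a * vm * t ^+ 2) => err errle wu Fwu Fu_ge xle.
have tF : `|t * (Fw - Fu)| <= `|t| * v_min / 6.
  by rewrite normrM -mulrA ler_wpM2l.
have tFu : `|t| * v_min <= Num.sg t * Num.sg Fu * (t * Fu).
  rewrite mulrACA -!normrEsg; rewrite ler_wpM2l//.
have xz : `|x + z - t * Fu| <= `|t| * v_min / 2.
  have -> : x + z - t * Fu = (x - t * Fw) + z + t * (Fw - Fu) by ring.
  rewrite (le_trans (ler_normD _ _))//.
  by have := ler_normD (x - t * Fw) z; lra.
have : `|Num.sg t * Num.sg Fu * (x + z - t * Fu)| <= `|t| * v_min / 2.
  apply: le_trans xz; rewrite !normrM -[leRHS]mul1r ler_wpM2r//.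
  by rewrite !normr_sg mulr_ile1//; case: eqP.
by rewrite ler_norml mulrBr => /andP[+ _]; lra.
Qed.

Variables t_max : R.
Hypothesis t_max_bounds : 0 < t_max < v_min / (6 * a * vm).
Hypothesis hyp_c : forall v, eball r v -> ~ leaf_tube Psi r h eps u t_max v ->
  exists i : nat, 2 * eps < obs_gap Psi h u v i.

(** A point v consistent with all observations has gaps at most 2 eps, so it is in the
tube, at some time t from a point w of the leaf set.  If t is not 0, take the sign
opposite to that of t: infinitely often the noise is, within 1/(n+1), extreme in the
direction opposite to the displacement v_i - u_i, and the observation ends up farther
than eps from v_i. *)
Lemma consistent_limit (z : nat -> 'rV[R]_d) :
  (forall i, `|z i| <= eps) ->
  (forall (n : nat) (b : bool) (N : nat), exists i j, [/\ (N <= i)%N,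
     v_min <= `|F (obs i u) 0 j| &
     eps - n.+1%:R^-1 <= (-1) ^+ b * Num.sg (F (obs i u) 0 j) * z i 0 j]) ->
  \bigcap_k consistent (fun i => obs i u + z i) k `<=` U.
Proof.
move=> z_eps exc v vK.
have vr : eball r v by have [] := vK 0%N.
have vz i : `|obs i u + z i - obs i v| <= eps by have [_] := vK i I; apply.
have : leaf_tube Psi r h eps u t_max v.
  apply: contrapT => /(hyp_c vr)[i]; apply/negP; rewrite -leNgt /obs_gap distrC.
  have -> : obs i u - obs i v = (obs i u + z i - obs i v) - z i.
    by apply/rowP => j; rewrite !mxE; ring.
  by rewrite (le_trans (ler_normB _ _))// mulr_natl mulr2n lerD.
move=> [_ _ [w [t [Uw tmax vw]]]].
have [t0|t0] := eqVneq t 0.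
  case: vw => -[]; rewrite t0 ?ltxx// => _ <-.
  by rewrite (flow0 Psi_sol)//; case: Uw.
have tt0 : 0 < `|t| by rewrite normr_gt0.
(* Division by 0 gives 0, so the bounds on t_max exclude a vanishing denominator. *)
have avm0 : 0 < 6 * a * vm.
  have: 0 <= 6 * a * vm by rewrite !mulr_ge0 ?a_max_ge0 ?v_max_ge0 ?(ltW r_gt0).
  rewrite le_eqVlt => /predU1P[E|//]; move: t_max_bounds.
  by rewrite -E invr0 mulr0 => /andP[/lt_trans/[apply]]; rewrite ltxx.
have tsmall : 6 * (a * vm) * `|t| <= v_min.
  move: t_max_bounds => /andP[_ /ltW]; rewrite ler_pdivlMr// => tm.
  rewrite mulrA mulrC (le_trans _ tm)// ler_wpM2r ?(ltW avm0)//.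
  by rewrite ler_norml.
have [N NP] := leaf_separation vr Uw t0 tsmall vw.
have gap0 : 0 < `|t| * (v_min / 2) by rewrite mulr_gt0// divr_gt0.
have [n n_lt] : exists n : nat, n.+1%:R^-1 < `|t| * (v_min / 2).
  have [n _ /(_ n (leqnn n))] := near_infty_natSinv_lt (PosNum gap0).
  by exists n.
(* The sign (-1) ^+ (0 <= t) is the one opposite to that of t. *)
have [i [j [Ni Fi]]] := exc n (0 <= t) N.
have -> : (-1) ^+ (0 <= t)%R = - Num.sg t :> R.
  by move: t0; case: sgrP => // _ _; rewrite ?expr1 ?expr0 ?opprK.
have := NP i j Ni Fi; set sF := Num.sg (F _ 0 j) => h1 h2.
suff : eps < `|obs i u + z i - obs i v| by rewrite ltNge vz.
apply: (@lt_le_trans _ _ (- Num.sg t * sF * (obs i u + z i - obs i v) 0 j)).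
  move: h1 h2 n_lt; rewrite !mxE.
  by move: (Num.sg t) sF n.+1%:R^-1 => st s1 n1; lra.
apply: le_trans (coord_le_norm _ j); apply: le_trans (ler_norm _) _.
rewrite !normrM normrN -[leRHS]mul1r ler_wpM2r//.
by rewrite !normr_sg mulr_ile1//; case: eqP.
Qed.

End leaf_separation.

(** * Uniform noise *)

Section uniform_noise.
Context {R : realType} {d : nat} {dT : measure_display} {T : measurableType dT}.
Variables (P : probability T R) (Z : nat -> {RV P >-> 'rV[R]_d}) (eps : R).
Hypotheses (eps_gt0 : 0 < eps) (Z_iid : iid_uniform Z eps).
Implicit Types (a b z : 'rV[R]_d) (E : nat -> set 'rV[R]_d).

Definition box a b : set 'rV[R]_d := [set z | forall j, a 0 j <= z 0 j <= b 0 j].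

Lemma measurable_box a b : measurable (box a b).
Proof.
rewrite (_ : box a b = \bigcap_(j in [set: 'I_d])
    ((fun z : 'rV[R]_d => z 0 j) @^-1` `[a 0 j, b 0 j])).
  apply: fin_bigcap_measurable => // j _.
  by rewrite -[X in measurable X]setTI; exact: measurable_rV_coord.
apply/seteqP; split => z /= zb; first by move=> j _ /=; rewrite in_itv/= zb.
by move=> j; have := zb j I; rewrite /= in_itv.
Qed.

Lemma lebesgue_box a b : (forall j, a 0 j <= b 0 j) ->
  lebesgue_rV R d (box a b) = (\prod_j (b 0 j - a 0 j))%:E.
Proof.
move=> ab.
have -> : box a b = [set z | forall j, `[a 0 j, b 0 j]%classic (z 0 j)].
  by apply/seteqP; split => z /= zb j; have := zb j; rewrite /= in_itv.
rewrite (@lebesgue_rV_box _ _ (fun j => `[a 0 j, b 0 j]%classic))//.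
rewrite -prodEFin; apply: eq_bigr => j _; rewrite lebesgue_measure_itv/= lte_fin.
case: ltP => // ba.
by have -> : a 0 j = b 0 j; [apply/le_anti; rewrite ab|rewrite subrr].
Qed.

Lemma measurable_noise_preimage i (C : set 'rV[R]_d) : measurable C ->
  measurable (Z i @^-1` C).
Proof.
by move=> mC; rewrite -[X in measurable X]setTI; exact: measurable_funPT.
Qed.

Lemma noise_box i a b :
  (forall j, [/\ - eps <= a 0 j, a 0 j <= b 0 j & b 0 j <= eps]) ->
  P (Z i @^-1` box a b) = (\prod_j ((b 0 j - a 0 j) / (2 * eps)))%:E.
Proof.
move=> ab; have := Z_iid.2 i _ (measurable_box a b).
rewrite /distribution /pushforward => ->.
under eq_integral => z.
  rewrite inE => zab; rewrite /unif_density indicE mem_set; last first.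
    move=> j; have [aj _ bj] := ab j; have /andP[az zb] := zab j.
    by rewrite (le_trans aj az) (le_trans zb bj).
  over.
rewrite (integral_cst _ (measurable_box a b)).
transitivity (((2 * eps) ^+ d)^-1%:E * (\prod_j (b 0 j - a 0 j))%:E)%E.
  congr (_ * _)%E; first by rewrite div1r.
  by apply: lebesgue_box => j; have [] := ab j.
by rewrite -EFinM prodf_div prodr_const card_ord mulrC.
Qed.

Lemma noise_bounded : {ae P, forall x, forall i, `|Z i x| <= eps}.
Proof.
apply: ae_foralln => i.
pose C := box (const_mx (- eps)) (const_mx eps).
have mC : measurable (Z i @^-1` C).
  exact: (measurable_noise_preimage i (measurable_box _ _)).
exists (~` (Z i @^-1` C)); split.
- exact: measurableC.
- suff : P (~` (Z i @^-1` C)) = 0%E by [].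
  rewrite (probability_setC P mC) noise_box; last first.
    move=> j; rewrite !mxE; split; rewrite ?lexx//.
    by move: eps_gt0; lra.
  rewrite big1 ?subee// => j _; rewrite !mxE.
  rewrite (_ : eps - - eps = 2 * eps) ?divff//; last by ring.
  by rewrite mulf_neq0 ?gt_eqF.
- move=> x /=; apply: contra_not => xC; apply: norm_le_coord; first exact: ltW.
  by move=> j; have := xC j; rewrite !mxE ler_norml.
Qed.

(** The second Borel-Cantelli lemma for events of constant probability p: the event that
none of them occurs from N on is contained, for each n, in an intersection of at least
n independent complements, of probability at most (1 - p)^n. *)
Lemma noise_infinitely_often E (S : set nat) (p : R) : infinite_set S ->
  (forall i, measurable (E i)) -> 0 < p ->
  (forall i, S i -> P (Z i @^-1` E i) = p%:E) ->
  {ae P, forall x, forall N, exists i, [/\ S i, (N <= i)%N & E i (Z i x)]}.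
Proof.
move=> Sinf mE p0 pE; apply: ae_foralln => N.
pose C i := if `[< S i >] && (N <= i)%N then ~` E i else setT.
have mC i : measurable (C i) by rewrite /C; case: ifP => // _; exact: measurableC.
pose G := \bigcap_i (Z i @^-1` C i).
have mG : measurable G.
  by apply: bigcapT_measurable => i; exact/measurable_noise_preimage.
exists G; split=> //; last first.
  move=> x /= nx i _ /=; rewrite /C; case: ifPn => // /andP[/asboolP Si Ni] Ex.
  by apply: nx; exists i.
have p1 : p <= 1.
  have [i Si] := infinite_setN0 Sinf.
  by rewrite -lee_fin -(pE i Si) probability_le1//; exact/measurable_noise_preimage.
have SN : infinite_set (S `\` `I_N) by exact: infinite_setD.
have GP n : (P G <= ((1 - p) ^+ n)%:E)%E.
  have [J JS nJ] := infinite_set_fset n SN.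
  have PJ : (P G <= P (\bigcap_(i in [set` J]) (Z i @^-1` C i)))%E.
    apply: le_measure; rewrite ?inE//.
      by apply: fin_bigcap_measurable => // i _; exact: measurable_noise_preimage.
    by move=> x Gx i _; exact: Gx.
  apply: (le_trans PJ); rewrite Z_iid.1//.
  rewrite (eq_big_seq (fun=> (1 - p)%:E)); last first.
    move=> i /JS[Si /negP Ni]; rewrite /C asboolT//= leqNgt Ni preimage_setC.
    rewrite probability_setC ?pE//; exact: measurable_noise_preimage.
  rewrite prodEFin lee_fin big_const_seq count_predT iter_mulr_1.
  by rewrite ler_wiXn2l// ?subr_ge0// lerBlDr lerDl ltW.
have PG0 : (0 <= P G)%E by exact: measure_ge0.
have PGfin : P G \is a fin_num by exact: fin_num_measure.
suff : P G = 0%E by [].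
apply/eqP; rewrite eq_le PG0 andbT -(fineK PGfin) lee_fin.
have cv : ((1 - p) ^+ n @[n --> \oo] --> (0 : R))%classic.
  by apply: cvg_expr; rewrite ger0_norm ?subr_ge0//; lra.
rewrite -(cvg_lim _ cv)//; apply: limr_ge; first by apply/cvg_ex; exists 0.
by apply: nearW => n; rewrite -lee_fin fineK.
Qed.

(** The noise comes infinitely often within c of a prescribed extreme value eps or - eps
of a prescribed coordinate: each time this has the probability of a box of relative
volume min(c, 2 eps) / (2 eps). *)
Lemma noise_extreme (S : set nat) (jS : nat -> 'I_d) (sg : nat -> bool) (c : R) :
  infinite_set S -> 0 < c -> {ae P, forall x, forall N, exists i,
    [/\ S i, (N <= i)%N & eps - c <= (-1) ^+ sg i * Z i x 0 (jS i)]}.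
Proof.
move=> Sinf c0; pose c' := Num.min c (2 * eps).
have c'0 : 0 < c' by rewrite lt_min c0 mulr_gt0.
have c'e : c' <= 2 * eps by rewrite ge_min lexx orbT.
have c'c : c' <= c by rewrite ge_min lexx.
pose lo i : 'rV[R]_d := \row_j
  (if (j == jS i) && ~~ sg i then eps - c' else - eps).
pose hi i : 'rV[R]_d := \row_j
  (if (j == jS i) && sg i then c' - eps else eps).
have lohi i j : [/\ - eps <= lo i 0 j, lo i 0 j <= hi i 0 j & hi i 0 j <= eps].
  by rewrite !mxE; move: eps_gt0; case: (j == _) (sg i) => -[] /=; split; lra.
have pE i : P (Z i @^-1` box (lo i) (hi i)) = (c' / (2 * eps))%:E.
  rewrite noise_box//; congr (_%:E); rewrite (bigD1 (jS i))//= big1 ?mulr1 => [|j ji].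
    by rewrite !mxE eqxx /=; case: (sg i) => /=; congr (_ / _); ring.
  rewrite !mxE (negbTE ji)/= (_ : eps - - eps = 2 * eps) ?divff//; last by ring.
  by rewrite mulf_neq0 ?gt_eqF.
have := @noise_infinitely_often (fun i => box (lo i) (hi i)) S (c' / (2 * eps)) Sinf.
have pr : 0 < c' / (2 * eps) by rewrite divr_gt0// mulr_gt0.
move=> /(_ (fun i => measurable_box _ _) pr (fun i _ => pE i)); apply: filterS => x xio N.
have [i [Si Ni /(_ (jS i))]] := xio N; rewrite !mxE eqxx/= => zlh.
exists i; split=> //; move: zlh.
by case: (sg i) => /= /andP[z1 z2]; rewrite ?expr1 ?expr0; lra.
Qed.

(** The coordinate is one where w i is large, and the sign is, up to the global choice b,
that of this entry.  Both are fixed before the noise is drawn, so that the almost sure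
event does not depend on the point that is later tested against it. *)
Lemma noise_extreme_along (w : nat -> 'rV[R]_d) (c : R) : 0 < c ->
  infinite_set [set i | c <= `|w i|] ->
  {ae P, forall x, forall (n : nat) (b : bool) (N : nat), exists i j,
    [/\ (N <= i)%N, c <= `|w i 0 j| &
        eps - n.+1%:R^-1 <= (-1) ^+ b * Num.sg (w i 0 j) * Z i x 0 j]}.
Proof.
move=> c0 Sinf; set S := [set i | _] in Sinf.
have [j0 _] : exists j : 'I_d, True.
  have [i wi] := infinite_setN0 Sinf.
  by have [j _] := norm_coord_ex c0 wi; exists j.
have /choice[jS jSP] : forall i, exists j, S i -> c <= `|w i 0 j|.
  move=> i; have [/(norm_coord_ex c0)[j jP]|nS] := pselect (S i); first by exists j.
  by exists j0.
pose neg i := w i 0 (jS i) < 0.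
apply: ae_foralln => n.
have n0 : (0 : R) < n.+1%:R^-1 by rewrite invr_gt0.
have ext (b : bool) := noise_extreme jS (fun i => b (+) neg i) Sinf n0.
suff sgE (b : bool) i : S i ->
    (-1) ^+ (b (+) neg i) = (-1) ^+ b * Num.sg (w i 0 (jS i)) :> R.
  apply: filterS2 (ext true) (ext false) => x x1 x0 b N.
  have [i [Si Ni xi]] : exists i, [/\ S i, (N <= i)%N &
      eps - n.+1%:R^-1 <= (-1) ^+ (b (+) neg i) * Z i x 0 (jS i)].
    by case: b; [exact: x1|exact: x0].
  by exists i, (jS i); split=> //; [exact: jSP|rewrite -sgE].
move=> /jSP wi; rewrite sgr_def signr_addb.
by rewrite -normr_gt0 (lt_le_trans c0 wi) mulr1n.
Qed.

Lemma noise_all E k : (forall i, measurable (E i)) ->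
  P [set x | forall i, (i <= k)%N -> E i (Z i x)] =
  (\prod_(0 <= i < k.+1) P (Z i @^-1` E i))%E.
Proof.
move=> mE; pose J := seq_fset tt (iota 0 k.+1).
have Jk i : (i \in J) = (i <= k)%N by rewrite seq_fsetE mem_iota.
have -> : [set x | forall i, (i <= k)%N -> E i (Z i x)] =
    \bigcap_(i in [set` J]) (Z i @^-1` E i).
  by apply/seteqP; split => x /= xE i; have := xE i; rewrite /= ?Jk.
rewrite Z_iid.1//; apply: perm_big.
by rewrite -[X in perm_eq _ X]undup_id ?iota_uniq//; exact: seq_fset_perm.
Qed.

Lemma noise_all_ge E (a : nat -> R) k : (forall i, measurable (E i)) ->
  (forall i, 0 <= a i) -> (forall i, ((a i)%:E <= P (Z i @^-1` E i))%E) ->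
  ((\prod_(0 <= i < k.+1) a i)%:E <=
    P [set x | forall i, (i <= k)%N -> E i (Z i x)])%E.
Proof.
move=> mE a0 aP; rewrite noise_all// -prodEFin.
suff /andP[] : (0 <= \prod_(0 <= i < k.+1) (a i)%:E <=
  \prod_(0 <= i < k.+1) P (Z i @^-1` E i))%E by [].
elim/big_rec2 : _ => [|i y x _ /andP[x0 xy]]; first by rewrite lee01 lexx.
by rewrite mule_ge0 ?lee_fin//= lee_pmul// lee_fin.
Qed.

Lemma norm_ball_box a : [set z : 'rV[R]_d | `|z - a| <= eps] =
  box (a - const_mx eps) (a + const_mx eps).
Proof.
apply/seteqP; split => z /=.
  move=> za j; have := le_trans (coord_le_norm _ j) za.
  by rewrite !mxE ler_norml => /andP[z1 z2]; apply/andP; split; lra.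
move=> za; apply: norm_le_coord => [|j]; first exact: ltW.
by have := za j; rewrite !mxE ler_norml => /andP[z1 z2]; apply/andP; split; lra.
Qed.

(** The cubes of half-width eps around 0 and around a meet in a box with sides
2 eps - |a_j|. *)
Lemma noise_near_ge i a (g : R) : `|a| <= g -> g <= 2 * eps ->
  (((1 - g / (2 * eps)) ^+ d)%:E <= P (Z i @^-1` [set z | (`|z - a| <= eps)%R]))%E.
Proof.
move=> ag ge; have e2 : 0 < 2 * eps by rewrite mulr_gt0.
pose lo : 'rV[R]_d := \row_j Num.max (- eps) (a 0 j - eps).
pose hi : 'rV[R]_d := \row_j Num.min eps (a 0 j + eps).
have aj j : `|a 0 j| <= g by exact: le_trans (coord_le_norm _ _) ag.
have width j : 2 * eps - g <= hi 0 j - lo 0 j.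
  rewrite !mxE /Num.max /Num.min; have := aj j; rewrite ler_norml => /andP[a1 a2].
  by move: eps_gt0; do 2 case: ifPn; rewrite -?leNgt => *; lra.
have lohi j : [/\ - eps <= lo 0 j, lo 0 j <= hi 0 j & hi 0 j <= eps].
  split; last by rewrite mxE ge_min lexx.
    by rewrite mxE le_max lexx.
  by rewrite -subr_ge0 (le_trans _ (width j))// subr_ge0.
have sub : box lo hi `<=` [set z | `|z - a| <= eps].
  rewrite norm_ball_box => z zb j; have := zb j; rewrite !mxE ge_max le_min.
  by move=> /andP[/andP[_ z1] /andP[_ z2]]; rewrite z1 z2.
have lePP : (P (Z i @^-1` box lo hi) <= P (Z i @^-1` [set z | (`|z - a| <= eps)%R]))%E.
  apply: le_measure; rewrite ?inE.
  - exact: (measurable_noise_preimage i (measurable_box _ _)).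
  - rewrite norm_ball_box.
    exact: (measurable_noise_preimage i (measurable_box _ _)).
  - by move=> x; exact: sub.
apply: le_trans lePP; rewrite noise_box// lee_fin.
rewrite -[X in _ ^+ X]card_ord -prodr_const; apply: ler_prod => j _.
rewrite subr_ge0 ler_pdivrMr// mul1r ge/=.
by rewrite ler_pdivlMr// mulrBl mul1r divfK ?gt_eqF.
Qed.

End uniform_noise.

(** * The support of the smoothing density *)

Section smoothing_support.
Context {R : realType} {d : nat}.
Variables (Psi : R -> 'rV[R]_d -> 'rV[R]_d) (r h eps : R) (q : 'rV[R]_d -> R).
Hypothesis eps_gt0 : 0 < eps.
Implicit Types (v z : 'rV[R]_d) (Y : nat -> 'rV[R]_d).

Lemma unif_density_neq0 z : (unif_density eps z != 0) = (`|z| <= eps).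
Proof.
have e0 : (2 * eps) ^+ d != 0 by rewrite expf_neq0// mulf_neq0// gt_eqF.
rewrite /unif_density mulf_eq0 invr_eq0 (negbTE e0) orbF indicE pnatr_eq0 eqb0 negbK.
apply/idP/idP; rewrite inE /= => zeps.
  by apply: norm_le_coord; [exact: ltW|move=> j; rewrite ler_norml].
by move=> j; rewrite -ler_norml (le_trans (coord_le_norm _ _)).
Qed.

Lemma smoothing_suppE k Y v :
  smoothing_supp Psi r h eps q k Y v <-> q v != 0 /\ consistent r Psi h eps Y k v.
Proof.
rewrite /smoothing_supp/= /smoothing_density mulf_eq0 invr_eq0 negb_or.
have -> : smoothing_const Psi r h eps q k Y != 0.
  by rewrite /smoothing_const; case: ifPn => //; rewrite oner_eq0.
rewrite andbT /smoothing_weight !mulf_eq0 !negb_or indicE pnatr_eq0 eqb0 negbK.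
have -> : (\prod_(i < k.+1) unif_density eps (Y i - Psi (obs_time h i) v) != 0) =
    [forall i : 'I_k.+1, unif_density eps (Y i - Psi (obs_time h i) v) != 0].
  by apply/prodf_neq0/forallP => // H i; exact: H.
split.
  move=> /and3P[/set_mem vr qv /forallP/= vY]; split=> //; split=> // i ik.
  by rewrite -unif_density_neq0; exact: (vY (Ordinal (ik : (i < k.+1)%N))).
move=> [qv [vr vY]]; apply/and3P; split=> //; first exact: mem_set.
by apply/forallP => i /=; rewrite unif_density_neq0 vY// -ltnS.
Qed.

Context {dT : measure_display} {T : measurableType dT}.
Variables (P : probability T R) (Z : nat -> {RV P >-> 'rV[R]_d}).
Hypothesis Z_iid : iid_uniform Z eps.
Variable u : 'rV[R]_d.
Local Notation U := (cropped_leaf Psi r h eps u).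
Local Notation supp k z :=
  (smoothing_supp Psi r h eps q k (fun i => Psi (obs_time h i) u + z i)).

(** The support contains v exactly when every noise z_i is within eps of v_i - u_i;
these are independent events, and their probabilities are at least
(1 - |v_i - u_i| / (2 eps))^d. *)
Lemma smoothing_supp_probability v : U v -> 0 < q v ->
  exists2 c : R, 0 < c & forall k, (c%:E <= P [set x | supp k (Z ^~ x) v])%E.
Proof.
move=> [vr gfin gsup] qv.
pose g i := obs_gap Psi h u v i / (2 * eps).
have e2 : 0 < 2 * eps by rewrite mulr_gt0.
have gap_lt i : obs_gap Psi h u v i < 2 * eps.
  rewrite -lte_fin (le_lt_trans _ gsup)//; apply: ereal_sup_ubound.
  by exists i.
have g01 i : 0 <= g i < 1.
  by rewrite divr_ge0 ?normr_ge0 ?(ltW e2)//= ltr_pdivrMr// mul1r.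
have gsum : (\sum_(0 <= i <oo) (g i)%:E < +oo)%E.
  under eq_eseriesr do rewrite /g mulrC EFinM.
  rewrite nneseriesZl; last by move=> i _; rewrite lee_fin normr_ge0.
  by rewrite lte_mul_pinfty// lee_fin invr_ge0 ltW.
have [c c0 cP] := prod_one_sub_bounded_below g01 gsum.
exists (c ^+ d); first by rewrite exprn_gt0.
move=> k; pose E i := [set z : 'rV[R]_d |
  `|z - (Psi (obs_time h i) v - Psi (obs_time h i) u)| <= eps].
have -> : [set x | supp k (Z ^~ x) v] =
    [set x | forall i, (i <= k)%N -> E i (Z i x)].
  have subE x i : Psi (obs_time h i) u + Z i x - Psi (obs_time h i) v =
      Z i x - (Psi (obs_time h i) v - Psi (obs_time h i) u).
    by apply/rowP => j; rewrite !mxE; ring.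
  apply/seteqP; split => x /=.
    by move=> /smoothing_suppE[_ [_ vY]] i ik; rewrite /E/= -subE vY.
  move=> xE; apply/smoothing_suppE; split; first by rewrite gt_eqF.
  by split=> // i ik; rewrite subE; exact: xE.
apply: (@le_trans _ _ (\prod_(0 <= i < k.+1) (1 - g i) ^+ d)%:E).
  rewrite lee_fin prodrXl.
  by apply: lerXn2r; rewrite ?nnegrE ?(ltW c0)// (le_trans (ltW c0))// cP.
apply: (noise_all_ge Z_iid) => i.
- by rewrite /E (norm_ball_box eps_gt0); exact: measurable_box.
- by rewrite exprn_ge0// subr_ge0; case/andP: (g01 i) => _ /ltW.
- by apply: (noise_near_ge eps_gt0 Z_iid) => //; exact: ltW.
Qed.

(** The point u always belongs to the support.  This keeps the supremum nonnegative;
that of the empty set would be -oo. *)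
Lemma smoothing_supp_dist_cvg (z : nat -> 'rV[R]_d) :
  eball r u -> 0 < q u -> (forall i, `|z i| <= eps) ->
  (forall e : R, 0 < e -> exists N, forall v,
    consistent r Psi h eps (fun i => Psi (obs_time h i) u + z i) N v ->
    dist_to v U < e) ->
  ereal_sup [set (dist_to v U)%:E | v in supp k z] @[k --> \oo] --> (0 : \bar R).
Proof.
move=> ur qu zeps near_U.
have Ux k : supp k z u.
  apply/smoothing_suppE; split; first by rewrite gt_eqF.
  by split=> // i _; rewrite addrAC subrr add0r.
have sup_ge0 k : (0 <= ereal_sup [set (dist_to v U)%:E | v in supp k z])%E.
  apply: (@le_trans _ _ (dist_to u U)%:E); first by rewrite lee_fin dist_to_ge0.
  by apply: ereal_sup_ubound; exists u.
have sup_le e : 0 < e -> \forall k \near \oo,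
    (ereal_sup [set (dist_to v U)%:E | v in supp k z] <= e%:E)%E.
  move=> e0; have [N NP] := near_U e e0.
  exists N => // k Nk; apply: ge_ereal_sup => _ [v + <-].
  move=> /smoothing_suppE[_ [vr vY]].
  rewrite lee_fin ltW// NP//; split=> // i iN; apply: vY.
  exact: leq_trans Nk.
apply/(@fine_cvgP _ _ _ _ _ 0); split.
  apply: filterS (sup_le 1 ltr01) => k k1.
  by rewrite ge0_fin_numE//; exact: le_lt_trans k1 (ltry _).
apply/cvgrPdist_le => e e0; apply: filterS (sup_le e e0) => k ke.
rewrite sub0r normrN /= ger0_norm ?fine_ge0//.
by rewrite -lee_fin fineK// ge0_fin_numE//; exact: le_lt_trans ke (ltry _).
Qed.

End smoothing_support.

Unset Implicit Arguments.
Set Strict Implicit.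

(** * Concentration of the smoothing distribution on the leaf set *)

Theorem theorem3p3
  (R : realType) (d : nat)
  (A : {linear 'rV[R]_d -> 'rV[R]_d})
  (B : {bilinear 'rV[R]_d -> 'rV[R]_d -> 'rV[R]_d}) (f : 'rV[R]_d)
  (r : R) (r_gt0 : 0 < r) (trap : trapping_ball A B f r)
  (Psi : R -> 'rV[R]_d -> 'rV[R]_d)
  (Psi_sol : solution_map (vfield A B f) r Psi)
  (h : R) (h_gt0 : 0 < h) (eps : R) (eps_gt0 : 0 < eps)
  (dT : measure_display) (T : measurableType dT) (P : probability T R)
  (Z : nat -> {RV P >-> 'rV[R]_d}) (Z_iid : iid_uniform Z eps)
  (q : 'rV[R]_d -> R) (q_prior : is_prior r q)
  (u : 'rV[R]_d) (u_ball : eball r u)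
  (v_min : R) (v_min_gt0 : 0 < v_min)
  (hyp_a : infinite_set
     [set i : nat | v_min <= `|derive1 (Psi^~ u) (obs_time h i)|])
  (rho : nat -> R) (rho_cvg0 : rho k @[k --> \oo] --> (0 : R))
  (hyp_b : forall v, cropped_leaf Psi r h eps u v -> forall k : nat,
     (\sum_(k <= i <oo) (obs_gap Psi h u v i)%:E <= (rho k)%:E)%E)
  (t_max : R)
  (t_max_bounds : 0 < t_max < v_min / (6 * a_max A B r * v_max A B f r))
  (hyp_c : forall v, eball r v -> ~ leaf_tube Psi r h eps u t_max v ->
     exists i : nat, 2 * eps < obs_gap Psi h u v i)
  (q_pos : forall v, cropped_leaf Psi r h eps u v -> 0 < q v) :
  let U := cropped_leaf Psi r h eps u in
  let Y (x : T) (i : nat) : 'rV[R]_d := Psi (obs_time h i) u + Z i x in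
  let supp (k : nat) (x : T) := smoothing_supp Psi r h eps q k (Y x) in
  {ae P, forall x, ereal_sup [set (dist_to v U)%:E | v in supp k x]
                     @[k --> \oo] --> (0 : \bar R)} /\
  (forall v, U v ->
     (0 < ereal_inf (range (fun k : nat => P [set x | supp k x v])))%E).
Proof.
move=> U Y supp.
have Uu : U u by exact: cropped_leaf_refl.
have speed i : (0 < i)%N ->
    derive1 (Psi^~ u) (obs_time h i) = vfield A B f (Psi (obs_time h i) u).
  move=> i0; rewrite derive1E; apply: derive_val.
  have [_ _] := Psi_sol _ u_ball; apply.
  by rewrite /obs_time mulr_gt0// ltr0n.
split; last first.
  move=> v Uv; have [c c0 cP] := smoothing_supp_probability eps_gt0 Z_iid Uv (q_pos _ Uv).
  apply: (@lt_le_trans _ _ c%:E); first by rewrite lte_fin.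
  by apply: le_ereal_inf_tmp => _ [k _ <-]; exact: cP.
apply: filterS2 (noise_bounded eps_gt0 Z_iid)
  (noise_extreme_along eps_gt0 Z_iid v_min_gt0 hyp_a) => x zx xext.
apply: (smoothing_supp_dist_cvg eps_gt0 u_ball (q_pos _ Uu) zx).
apply: (consistent_dist r_gt0 trap Psi_sol h_gt0).
apply: (consistent_limit r_gt0 trap Psi_sol h_gt0 u_ball v_min_gt0
  t_max_bounds hyp_c zx) => n b N.
(* The derivative of a solution is the vector field at positive times only. *)
have [i [j [Ni]]] := xext n b (maxn N 1).
move: Ni; rewrite geq_max => /andP[Ni i0]; rewrite speed// => Fi zi.
by exists i, j.
Qed.
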